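(* Let $X$ be a Tychonoff space such that $C_c(X)$ is a Fréchet locally convex space. Then the following are equivalent: (a) $C_c(X)$ is a weakly $\aleph$-space; (b) $C_c(X)$ is a weakly $\aleph_0$-space; (c) $X$ is countable.
   Context: $C_c(X)$ denotes the space of all continuous real-valued functions on $X$ with the compact-open topology. A Fréchet lcs is a metrizable complete locally convex space. A family $\mathcal N$ of subsets of a topological space $Y$ is a $k$-network if whenever $K\subset U$ with $K$ compact and $U$ open in $Y$, there is a finite $\mathcal F\subset\mathcal N$ with $K\subset\bigcup\mathcal F\subset U$. A space is an $\aleph_0$-space if it is regular and has a countable $k$-network, and an $\aleph$-space if it is regular and has a $\sigma$-locally finite $k$-network. A locally convex space $E$ is a weakly $\aleph$-space (resp. weakly $\aleph_0$-space) if $E$ endowed with its weak topology $\sigma(E,E')$ is an $\aleph$-space (resp. $\aleph_0$-space). *)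

(* Defs.v *)
From Stdlib Require Import Reals Lra List FunctionalExtensionality PropExtensionality.
Open Scope R_scope.

Record topology (T : Type) := Topology {
  open : (T -> Prop) -> Prop;
  open_full : open (fun _ => True);
  open_inter : forall A B, open A -> open B -> open (fun x => A x /\ B x);
  open_union : forall F : (T -> Prop) -> Prop,
      (forall A, F A -> open A) -> open (fun x => exists A, F A /\ A x) }.
Arguments open {T} t A.

Definition gen_open {T} (sub : (T -> Prop) -> Prop) (A : T -> Prop) : Prop :=
  forall x, A x -> exists l : list (T -> Prop),
    (forall B, In B l -> sub B /\ B x) /\
    (forall y, (forall B, In B l -> B y) -> A y).

Lemma gen_open_full {T} (sub : (T -> Prop) -> Prop) : gen_open sub (fun _ => True).
Proof. intros x _. exists nil. split; [intros B H; destruct H | auto]. Qed.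

Lemma gen_open_inter {T} (sub : (T -> Prop) -> Prop) A B :
  gen_open sub A -> gen_open sub B -> gen_open sub (fun x => A x /\ B x).
Proof.
  intros HA HB x [Ax Bx].
  destruct (HA x Ax) as [l1 [H1 H1']]. destruct (HB x Bx) as [l2 [H2 H2']].
  exists (l1 ++ l2). split.
  - intros C HC. apply in_app_or in HC. destruct HC; auto.
  - intros y Hy. split; [apply H1' | apply H2']; intros C HC; apply Hy;
      apply in_or_app; auto.
Qed.

Lemma gen_open_union {T} (sub : (T -> Prop) -> Prop) (F : (T -> Prop) -> Prop) :
  (forall A, F A -> gen_open sub A) -> gen_open sub (fun x => exists A, F A /\ A x).
Proof.
  intros HF x [A [FA Ax]]. destruct (HF A FA x Ax) as [l [H1 H2]].
  exists l. split; auto. intros y Hy. exists A. auto.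
Qed.

Definition generated_topology {T} (sub : (T -> Prop) -> Prop) : topology T :=
  Topology T (gen_open sub) (gen_open_full sub) (gen_open_inter sub) (gen_open_union sub).

Definition R_open (U : R -> Prop) : Prop :=
  forall x, U x -> exists e, 0 < e /\ forall y, Rabs (y - x) < e -> U y.

Lemma R_open_full : R_open (fun _ => True).
Proof. intros x _. exists 1. split; [lra | auto]. Qed.

Lemma R_open_inter A B : R_open A -> R_open B -> R_open (fun x => A x /\ B x).
Proof.
  intros HA HB x [Ax Bx]. destruct (HA x Ax) as [e1 [He1 H1]].
  destruct (HB x Bx) as [e2 [He2 H2]]. exists (Rmin e1 e2).
  split. { apply Rmin_case; lra. }
  intros y Hy. split; [apply H1 | apply H2];
    [ apply Rlt_le_trans with (1 := Hy); apply Rmin_l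
    | apply Rlt_le_trans with (1 := Hy); apply Rmin_r ].
Qed.

Lemma R_open_union (F : (R -> Prop) -> Prop) :
  (forall A, F A -> R_open A) -> R_open (fun x => exists A, F A /\ A x).
Proof.
  intros HF x [A [FA Ax]]. destruct (HF A FA x Ax) as [e [He H]].
  exists e. split; auto. intros y Hy. exists A. auto.
Qed.

Definition R_top : topology R :=
  Topology R R_open R_open_full R_open_inter R_open_union.

Section Basic.
Context {T : Type} (t : topology T).

Definition closed (F : T -> Prop) : Prop := open t (fun x => ~ F x).

Definition compact (K : T -> Prop) : Prop :=
  forall G : (T -> Prop) -> Prop,
    (forall A, G A -> open t A) ->
    (forall x, K x -> exists A, G A /\ A x) ->
    exists l : list (T -> Prop),
      (forall A, In A l -> G A) /\ (forall x, K x -> exists A, In A l /\ A x).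

(** regular (no separation axiom built in) *)
Definition regular : Prop :=
  forall (F : T -> Prop) (x : T), closed F -> ~ F x ->
    exists U V, open t U /\ open t V /\ U x /\ (forall y, F y -> V y) /\
                (forall y, ~ (U y /\ V y)).

Definition k_network (N : (T -> Prop) -> Prop) : Prop :=
  forall K U, compact K -> open t U -> (forall x, K x -> U x) ->
    exists l : list (T -> Prop),
      (forall A, In A l -> N A) /\
      (forall x, K x -> exists A, In A l /\ A x) /\
      (forall A, In A l -> forall x, A x -> U x).

Definition locally_finite (N : (T -> Prop) -> Prop) : Prop :=
  forall x, exists V, open t V /\ V x /\
    exists l : list (T -> Prop), forall A, N A -> (exists y, A y /\ V y) -> In A l.

Definition sigma_locally_finite (N : (T -> Prop) -> Prop) : Prop :=
  exists Ns : nat -> ((T -> Prop) -> Prop),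
    (forall A, N A <-> exists n, Ns n A) /\ (forall n, locally_finite (Ns n)).

Definition countable_family (N : (T -> Prop) -> Prop) : Prop :=
  exists g : nat -> option (T -> Prop), forall A, N A <-> exists n, g n = Some A.

Definition aleph_space : Prop :=
  regular /\ exists N, k_network N /\ sigma_locally_finite N.

Definition aleph0_space : Prop :=
  regular /\ exists N, k_network N /\ countable_family N.

Definition T1 : Prop :=
  forall x y : T, x <> y -> exists U, open t U /\ U x /\ ~ U y.

End Basic.

Definition continuous {A B : Type} (tA : topology A) (tB : topology B) (f : A -> B) : Prop :=
  forall V, open tB V -> open tA (fun x => V (f x)).

Definition completely_regular {T : Type} (t : topology T) : Prop :=
  forall (F : T -> Prop) (x : T), closed t F -> ~ F x ->
    exists f : T -> R, continuous t R_top f /\ f x = 0 /\ (forall y, F y -> f y = 1).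

Definition tychonoff {T : Type} (t : topology T) : Prop :=
  T1 t /\ completely_regular t.

Definition countable_type (X : Type) : Prop :=
  exists g : nat -> option X, forall x, exists n, g n = Some x.

Lemma continuous_R_pointwise {X} (t : topology X) (f : X -> R) :
  continuous t R_top f ->
  forall x e, 0 < e -> exists V, open t V /\ V x /\ forall y, V y -> Rabs (f y - f x) < e.
Proof.
  intros Hf x e He.
  exists (fun y => Rabs (f y - f x) < e). split; [| split].
  - apply (Hf (fun r => Rabs (r - f x) < e)). simpl. intros r Hr.
    exists (e - Rabs (r - f x)). split; [lra |]. intros s Hs.
    pose proof (Rabs_triang (s - r) (r - f x)).
    replace (s - f x) with ((s - r) + (r - f x)) by ring. lra.
  - replace (f x - f x) with 0 by ring. rewrite Rabs_R0. lra.
  - auto.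
Qed.

Lemma pointwise_continuous_R {X} (t : topology X) (f : X -> R) :
  (forall x e, 0 < e -> exists V, open t V /\ V x /\ forall y, V y -> Rabs (f y - f x) < e) ->
  continuous t R_top f.
Proof.
  intros Hf U HU.
  set (F := fun V : X -> Prop => open t V /\ forall y, V y -> U (f y)).
  assert (E : (fun x => U (f x)) = (fun x => exists A, F A /\ A x)).
  { apply FunctionalExtensionality.functional_extensionality. intros x.
    apply PropExtensionality.propositional_extensionality. split.
    - intros Hx. destruct (HU (f x) Hx) as [e [He H]].
      destruct (Hf x e He) as [V [HV [Vx HV']]].
      exists V. split; [split; auto |]; auto.
    - intros [A [[_ HA] Ax]]. auto. }
  rewrite E. apply open_union. intros A [HA _]. exact HA.
Qed.

Section CX.
Context {X : Type} (tX : topology X).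

Definition CX : Type := { f : X -> R | continuous tX R_top f }.

Lemma cont_add (f g : X -> R) : continuous tX R_top f -> continuous tX R_top g ->
  continuous tX R_top (fun x => f x + g x).
Proof.
  intros Hf Hg. apply pointwise_continuous_R. intros x e He.
  destruct (continuous_R_pointwise tX f Hf x (e/2)) as [V1 [O1 [V1x H1]]]; [lra|].
  destruct (continuous_R_pointwise tX g Hg x (e/2)) as [V2 [O2 [V2x H2]]]; [lra|].
  exists (fun y => V1 y /\ V2 y). split; [apply open_inter; auto | split; auto].
  intros y [Hy1 Hy2]. specialize (H1 y Hy1). specialize (H2 y Hy2).
  replace (f y + g y - (f x + g x)) with ((f y - f x) + (g y - g x)) by ring.
  pose proof (Rabs_triang (f y - f x) (g y - g x)). lra.
Qed.

Lemma cont_scal (c : R) (f : X -> R) : continuous tX R_top f ->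
  continuous tX R_top (fun x => c * f x).
Proof.
  intros Hf. apply pointwise_continuous_R. intros x e He.
  pose proof (Rabs_pos c) as Hc.
  destruct (continuous_R_pointwise tX f Hf x (e / (Rabs c + 1))) as [V [O [Vx H]]].
  { apply Rdiv_lt_0_compat; lra. }
  exists V. split; [auto | split; auto]. intros y Hy. specialize (H y Hy).
  replace (c * f y - c * f x) with (c * (f y - f x)) by ring.
  rewrite Rabs_mult.
  assert (Rabs c * Rabs (f y - f x) <= Rabs c * (e / (Rabs c + 1))).
  { apply Rmult_le_compat_l; lra. }
  assert (Rabs c * (e / (Rabs c + 1)) < e).
  { unfold Rdiv. rewrite <- Rmult_assoc.
    apply Rmult_lt_reg_r with (Rabs c + 1); [lra|].
    rewrite Rmult_assoc, Rinv_l by lra. nra. }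
  lra.
Qed.

Lemma cont_zero : continuous tX R_top (fun _ => 0).
Proof.
  apply pointwise_continuous_R. intros x e He. exists (fun _ => True).
  split; [apply open_full | split; auto]. intros. rewrite Rminus_0_r, Rabs_R0. lra.
Qed.

Definition cadd (f g : CX) : CX :=
  exist _ (fun x => proj1_sig f x + proj1_sig g x) (cont_add _ _ (proj2_sig f) (proj2_sig g)).
Definition cscal (c : R) (f : CX) : CX :=
  exist _ (fun x => c * proj1_sig f x) (cont_scal c _ (proj2_sig f)).
Definition czero : CX := exist _ (fun _ => 0) cont_zero.
Definition csub (f g : CX) : CX := cadd f (cscal (-1) g).

Definition co_subbasis (B : CX -> Prop) : Prop :=
  exists K U, compact tX K /\ open R_top U /\
    B = (fun f : CX => forall x, K x -> U (proj1_sig f x)).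

Definition Cc : topology CX := generated_topology co_subbasis.

Definition convex (V : CX -> Prop) : Prop :=
  forall f g s, 0 <= s <= 1 -> V f -> V g -> V (cadd (cscal s f) (cscal (1 - s) g)).

Definition locally_convex_Cc : Prop :=
  forall U, open Cc U -> U czero ->
    exists V, open Cc V /\ V czero /\ convex V /\ (forall f, V f -> U f).

Definition metrizable_Cc : Prop :=
  exists d : CX -> CX -> R,
    (forall f g, d f g = 0 <-> f = g) /\
    (forall f g, d f g = d g f) /\
    (forall f g h, d f h <= d f g + d g h) /\
    (forall A, open Cc A <->
       forall f, A f -> exists r, 0 < r /\ forall g, d f g < r -> A g).

Definition proper_filter (F : (CX -> Prop) -> Prop) : Prop :=
  F (fun _ => True) /\ ~ F (fun _ => False) /\
  (forall A B, F A -> (forall f, A f -> B f) -> F B) /\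
  (forall A B, F A -> F B -> F (fun f => A f /\ B f)).

(** Cauchy for the translation-invariant uniformity of the TVS C_c(X) *)
Definition cauchy_filter (F : (CX -> Prop) -> Prop) : Prop :=
  forall U, open Cc U -> U czero ->
    exists A, F A /\ forall f g, A f -> A g -> U (csub f g).

Definition complete_Cc : Prop :=
  forall F, proper_filter F -> cauchy_filter F ->
    exists f, forall V, open Cc V -> V f -> F V.

Definition frechet_Cc : Prop :=
  locally_convex_Cc /\ metrizable_Cc /\ complete_Cc.

Definition linear_functional (phi : CX -> R) : Prop :=
  (forall f g, phi (cadd f g) = phi f + phi g) /\
  (forall c f, phi (cscal c f) = c * phi f).

Definition weak_subbasis (B : CX -> Prop) : Prop :=
  exists (phi : CX -> R) (U : R -> Prop),
    linear_functional phi /\ continuous Cc R_top phi /\ open R_top U /\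
    B = (fun f => U (phi f)).

Definition Cc_weak : topology CX := generated_topology weak_subbasis.

Definition weakly_aleph : Prop := aleph_space Cc_weak.
Definition weakly_aleph0 : Prop := aleph0_space Cc_weak.

End CX.

(* Main.v *)
(** Both implications rest on dominated convergence: bounded pointwise null sequences of
    continuous functions are weakly null in C_c(X). Metrizability of C_c(X) gives an
    increasing cofinal sequence K_n of compact subsets of X.

    If X is countable, then on sets of functions bounded on every K_n the weak topology is
    the pointwise one, and weakly compact sets are bounded on every K_n by a gliding hump
    argument. Hence the sets {|g| <= m on K_n} intersected with rational boxes for the
    topology of pointwise convergence form a countable k-network.

    Conversely, a sigma-locally finite k-network yields countably many sets A_i such that,
    for every point t, every bounded null sequence is eventually caught by finitely many A_i
    contained in {|f(t)| < 1}. Disjointly supported bumps then show that every continuous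
    map from X to R^nat has countable image. Using this and sigma-compactness of X, every t
    has a finite set F and a k such that all functions f with |f| <= 1 vanishing on F lie in
    the union of those A_i, i < k, that are contained in {|f(t)| < 1}. Functions separating t
    from F force t to be in F, and F depends only on k and on a subset of {0, ..., k-1}; so
    X is countable. *)

From Pilot Require Import Defs.
From Stdlib Require Import Reals List Lra Lia ZArith Arith Cantor.
From Stdlib Require Import Classical ClassicalEpsilon.
From Stdlib Require Import FunctionalExtensionality PropExtensionality.
(* [Reals] shadows [compact]. *)
Import Pilot.Defs.

(** * Extensionality, choice principles and Archimedean estimates *)

Lemma pred_ext {T : Type} (A B : T -> Prop) : (forall x, A x <-> B x) -> A = B.
Proof.
  intros H. apply functional_extensionality. intros x.
  apply propositional_extensionality. apply H.
Qed.

(** The second clause keeps witnesses traceable: every member of [l'] comes from a member of [l], so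
    a finite subcover can be pulled back to its indices. *)
Lemma list_choice {A B : Type} (Rel : A -> B -> Prop) (l : list A) :
  (forall a, In a l -> exists b, Rel a b) ->
  exists l', (forall a, In a l -> exists b, In b l' /\ Rel a b) /\
             (forall b, In b l' -> exists a, In a l /\ Rel a b).
Proof.
  induction l as [|a l IH]; intros H.
  - exists nil. split; intros ? [].
  - destruct IH as [l' [H1 H2]]. { intros; apply H; right; auto. }
    destruct (H a) as [b Hb]; [left; auto|].
    exists (b :: l'). split.
    + intros a' [<-|Ha]; [exists b; split; [left|]; auto|].
      destruct (H1 a' Ha) as [b' [? ?]]. exists b'. split; [right|]; auto.
    + intros b' [<-|Hb']; [exists a; split; [left|]; auto|].
      destruct (H2 b' Hb') as [a' [? ?]]. exists a'. split; [right|]; auto.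
Qed.

Lemma choice_fun {A B : Type} (Rel : A -> B -> Prop) :
  (forall a, exists b, Rel a b) -> exists f, forall a, Rel a (f a).
Proof.
  intros H.
  exists (fun a => proj1_sig (constructive_indefinite_description _ (H a))).
  intros a. destruct (constructive_indefinite_description _ (H a)); auto.
Qed.

Lemma dependent_choice {A : Type} (Rel : nat -> A -> A -> Prop) (a0 : A) :
  (forall n a, exists b, Rel n a b) ->
  exists s : nat -> A, s O = a0 /\ forall n, Rel n (s n) (s (S n)).
Proof.
  intros H.
  destruct (choice_fun (fun (p : nat * A) b => Rel (fst p) (snd p) b)) as [f Hf].
  { intros [n a]. apply H. }
  exists (fix s n := match n with O => a0 | S n => f (n, s n) end).
  split; auto. intros n. apply (Hf (n, _)).
Qed.

Lemma list_bound {A : Type} (P : A -> nat -> Prop) (l : list A) :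
  (forall a n m, P a n -> (n <= m)%nat -> P a m) ->
  (forall a, In a l -> exists n, P a n) ->
  exists n, forall a, In a l -> P a n.
Proof.
  intros Hm. induction l as [|a l IH]; intros H.
  - exists O. intros ? [].
  - destruct IH as [n Hn]. { intros; apply H; right; auto. }
    destruct (H a) as [n' Hn']; [left; auto|].
    exists (Nat.max n n'). intros b [<-|Hb]; eapply Hm; eauto; lia.
Qed.

Lemma exists_inv_succ_lt (r : R) : 0 < r -> exists n, / (INR n + 1) < r.
Proof.
  intros Hr. destruct (archimed_cor1 r Hr) as [n [Hn Hn']].
  exists n. apply Rle_lt_trans with (2 := Hn). apply Rinv_le_contravar.
  - apply lt_0_INR; lia.
  - lra.
Qed.

Lemma exists_INR_ge (r : R) : exists n, r <= INR n.
Proof.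
  destruct (archimed r) as [H _]. exists (Z.to_nat (up r)).
  destruct (Z_le_gt_dec 0 (up r)) as [Hz|Hz].
  - rewrite INR_IZR_INZ, Z2Nat.id by auto. lra.
  - pose proof (pos_INR (Z.to_nat (up r))).
    assert (IZR (up r) <= 0) by (apply IZR_le; lia). lra.
Qed.

Lemma inv_succ_le (n m : nat) : (n <= m)%nat -> / (INR m + 1) <= / (INR n + 1).
Proof.
  intros H. pose proof (pos_INR n). apply le_INR in H.
  apply Rinv_le_contravar; lra.
Qed.

Lemma inv_succ_pos (n : nat) : 0 < / (INR n + 1).
Proof. pose proof (pos_INR n). apply Rinv_0_lt_compat; lra. Qed.

(** * Codings by natural numbers *)

Fixpoint decode_list_aux (k n : nat) : list nat :=
  match k with
  | O => nil
  | S k => fst (Cantor.of_nat n) :: decode_list_aux k (snd (Cantor.of_nat n))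
  end.

Definition decode_list (n : nat) : list nat :=
  decode_list_aux (fst (Cantor.of_nat n)) (snd (Cantor.of_nat n)).

Lemma decode_list_surj (l : list nat) : exists n, decode_list n = l.
Proof.
  assert (H : exists n, decode_list_aux (length l) n = l).
  { induction l as [|a l [n Hn]]; [exists O; auto|].
    exists (Cantor.to_nat (a, n)). cbn [length decode_list_aux].
    rewrite Cantor.cancel_of_to. cbn. now rewrite Hn. }
  destruct H as [n Hn]. exists (Cantor.to_nat (length l, n)).
  unfold decode_list. rewrite Cantor.cancel_of_to. auto.
Qed.

Definition decode_pairs (n : nat) : list (nat * nat) :=
  map Cantor.of_nat (decode_list n).

Lemma decode_pairs_surj (l : list (nat * nat)) : exists n, decode_pairs n = l.
Proof.
  destruct (decode_list_surj (map Cantor.to_nat l)) as [n Hn].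
  exists n. unfold decode_pairs. rewrite Hn, map_map.
  rewrite (map_ext _ (fun p => p)); [apply map_id|]. intros; apply Cantor.cancel_of_to.
Qed.

Definition decode_triple (n : nat) : nat * nat * nat :=
  let (a, b) := Cantor.of_nat n in let (c, d) := Cantor.of_nat b in (a, c, d).

Lemma decode_triple_surj (a c d : nat) : exists n, decode_triple n = (a, c, d).
Proof.
  exists (Cantor.to_nat (a, Cantor.to_nat (c, d))).
  unfold decode_triple. rewrite !Cantor.cancel_of_to. auto.
Qed.

(** [P n] meets at most one class of [eqv], so one chosen representative per code suffices; a code
    without points gets [None]. *)
Lemma countable_by_codes {X : Type} (P : nat -> X -> Prop) (eqv : X -> X -> Prop) :
  (forall x, exists n, P n x) ->
  (forall n x y, P n x -> P n y -> eqv x y) ->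
  exists g : nat -> option X, forall x, exists n y, g n = Some y /\ eqv x y.
Proof.
  intros H1 H2.
  destruct (choice_fun (fun n o => forall x, P n x -> exists y, o = Some y /\ P n y))
    as [g Hg].
  { intros n. destruct (classic (exists x, P n x)) as [[x Hx]|Hn].
    - exists (Some x). intros; exists x; auto.
    - exists None. intros x Hx. exfalso; eauto. }
  exists g. intros x. destruct (H1 x) as [n Hn]. destruct (Hg n x Hn) as [y [E Hy]].
  exists n, y. split; eauto.
Qed.

(* The index codes a rational centre (p - q) / (r + 1) and a radius 1 / (r + 1);
   the positivity sets of the tents form a countable base of the line. *)
Definition tent (i : nat) (y : R) : R :=
  let '(p, q, r) := decode_triple i in
  / (INR r + 1) - Rabs (y - (INR p - INR q) / (INR r + 1)).

Lemma tent_lipschitz (i : nat) (y z : R) : Rabs (tent i y - tent i z) <= Rabs (y - z).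
Proof.
  unfold tent. destruct (decode_triple i) as [[p q] r].
  set (c := (INR p - INR q) / (INR r + 1)).
  unfold Rabs; repeat destruct Rcase_abs; lra.
Qed.

Lemma tent_base (y e : R) : 0 < e ->
  exists i, 0 < tent i y /\ forall z, 0 < tent i z -> Rabs (z - y) < e.
Proof.
  intros He. destruct (exists_inv_succ_lt (e / 2)) as [r Hr]; [lra|].
  pose proof (pos_INR r) as Hr0. pose proof (inv_succ_pos r) as Hri.
  assert (Hpq : exists p q, Rabs (y - (INR p - INR q) / (INR r + 1)) < / (INR r + 1)).
  (* The shift by 1/2 makes [up] round [y * (INR r + 1)] to an integer at distance at most 1/2; its
     positive and negative parts are [p] and [q]. *)
  { destruct (archimed (y * (INR r + 1) - 1 / 2)) as [A1 A2].
    set (z := up (y * (INR r + 1) - 1 / 2)) in *.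
    exists (Z.to_nat z), (Z.to_nat (- z)).
    replace (INR (Z.to_nat z) - INR (Z.to_nat (- z))) with (IZR z).
    2:{ rewrite !INR_IZR_INZ, <- minus_IZR. f_equal. lia. }
    replace (y - IZR z / (INR r + 1)) with ((y * (INR r + 1) - IZR z) * / (INR r + 1))
      by (field; lra).
    rewrite Rabs_mult, (Rabs_pos_eq (/ _)) by lra.
    rewrite <- (Rmult_1_l (/ (INR r + 1))) at 2.
    apply Rmult_lt_compat_r; auto.
    apply Rabs_def1; lra. }
  destruct Hpq as [p [q Hpq]]. destruct (decode_triple_surj p q r) as [i Hi].
  exists i. unfold tent. rewrite Hi.
  set (c := (INR p - INR q) / (INR r + 1)) in *.
  split; [lra|]. intros z Hz.
  revert Hpq Hz. unfold Rabs; repeat destruct Rcase_abs; lra.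
Qed.

(** * Topological generalities *)

Lemma open_locally {T : Type} (t : topology T) (A : T -> Prop) :
  (forall x, A x -> exists V, open t V /\ V x /\ forall y, V y -> A y) -> open t A.
Proof.
  intros H.
  rewrite (pred_ext A (fun x => exists V, (open t V /\ forall y, V y -> A y) /\ V x)).
  - apply open_union. intros V [HV _]; auto.
  - intros x. split.
    + intros Ax. destruct (H x Ax) as [V [? [? ?]]]. exists V; auto.
    + intros [V [[_ HV] Vx]]; auto.
Qed.

Lemma open_ext {T : Type} (t : topology T) (A B : T -> Prop) :
  (forall x, A x <-> B x) -> open t A -> open t B.
Proof. intros H. rewrite (pred_ext A B H). auto. Qed.

Lemma open_list_inter {T I : Type} (t : topology T) (l : list I) (B : I -> T -> Prop) :
  (forall i, In i l -> open t (B i)) -> open t (fun x => forall i, In i l -> B i x).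
Proof.
  induction l as [|i l IH]; intros H.
  - apply open_ext with (2 := open_full _ t).
    intros x; split; auto. intros _ i [].
  - apply open_ext with (A := fun x => B i x /\ forall j, In j l -> B j x).
    + intros x; split.
      * intros [H1 H2] j [<-|Hj]; auto.
      * intros Hx; split; [|intros]; apply Hx; [left|right]; auto.
    + apply open_inter; [apply H; left; auto|]. apply IH. intros; apply H; right; auto.
Qed.

Lemma gen_open_subbasic {T : Type} (sub : (T -> Prop) -> Prop) (B : T -> Prop) :
  sub B -> gen_open sub B.
Proof.
  intros HB x Bx. exists (B :: nil). split.
  - intros C [<-|[]]; auto.
  - intros y Hy. apply Hy. left; auto.
Qed.

Lemma R_open_ball (a e : R) : R_open (fun y => Rabs (y - a) < e).
Proof.
  intros x Hx. exists (e - Rabs (x - a)). split; [lra|]. intros y Hy.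
  replace (y - a) with ((y - x) + (x - a)) by ring.
  pose proof (Rabs_triang (y - x) (x - a)). lra.
Qed.

Lemma R_open_gt (a : R) : R_open (fun y => a < y).
Proof.
  intros x Hx. exists (x - a). split; [lra|]. intros y Hy.
  apply Rabs_def2 in Hy. lra.
Qed.

Lemma R_open_outside_ball (a e : R) : R_open (fun y => e < Rabs (y - a)).
Proof.
  intros x Hx. exists (Rabs (x - a) - e). split; [lra|]. intros y Hy.
  pose proof (Rabs_triang (x - y) (y - a)).
  replace (x - y + (y - a)) with (x - a) in * by ring.
  rewrite Rabs_minus_sym in Hy. lra.
Qed.

Lemma compact_list {T : Type} (t : topology T) (l : list T) : compact t (fun x => In x l).
Proof.
  intros G HG Hc. destruct (list_choice (fun x A => G A /\ A x) l Hc) as [l' [H1 H2]].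
  exists l'. split.
  - intros A HA. destruct (H2 A HA) as [x [_ [? _]]]; auto.
  - intros x Hx. destruct (H1 x Hx) as [A [? [_ ?]]]. eauto.
Qed.

Lemma compact_empty {T : Type} (t : topology T) : compact t (fun _ => False).
Proof. intros G HG Hc. exists nil. split; [intros A []|intros x []]. Qed.

Lemma compact_union {T : Type} (t : topology T) (K L : T -> Prop) :
  compact t K -> compact t L -> compact t (fun x => K x \/ L x).
Proof.
  intros HK HL G HG Hc.
  destruct (HK G HG) as [l1 [A1 B1]]; [auto|].
  destruct (HL G HG) as [l2 [A2 B2]]; [auto|].
  exists (l1 ++ l2). split.
  - intros A HA. apply in_app_or in HA. destruct HA; auto.
  - intros x [Hx|Hx]; [destruct (B1 x Hx) as [A [? ?]]|destruct (B2 x Hx) as [A [? ?]]];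
      exists A; split; auto; apply in_or_app; auto.
Qed.

Lemma compact_closed_inter {T : Type} (t : topology T) (K F : T -> Prop) :
  compact t K -> closed t F -> compact t (fun x => K x /\ F x).
Proof.
  intros HK HF G HG Hc.
  destruct (HK (fun A => G A \/ A = (fun x => ~ F x))) as [l [A1 B1]].
  - intros A [HA| ->]; auto.
  - intros x Kx. destruct (classic (F x)) as [Fx|Fx].
    + destruct (Hc x) as [A [? ?]]; eauto.
    + exists (fun x => ~ F x). auto.
  - exists (filter (fun A => if excluded_middle_informative (G A) then true else false) l).
    split.
    + intros A HA. apply filter_In in HA. destruct HA as [_ HA].
      destruct excluded_middle_informative; [auto|discriminate].
    + intros x [Kx Fx]. destruct (B1 x Kx) as [A [HA Ax]].
      exists A. split; auto. apply filter_In. split; auto.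
      destruct excluded_middle_informative as [|N]; auto.
      destruct (A1 A HA) as [|E]; [contradiction|]. subst A. contradiction.
Qed.

Lemma continuous_compact_bounded {T : Type} (t : topology T) (K : T -> Prop) (f : T -> R) :
  compact t K -> continuous t R_top f -> exists m, 0 <= m /\ forall x, K x -> Rabs (f x) <= m.
Proof.
  intros HK Hf.
  destruct (HK (fun A => exists n, A = (fun x => Rabs (f x - 0) < INR n))) as [l [A1 B1]].
  - intros A [n ->]. apply (Hf (fun y => Rabs (y - 0) < INR n)). apply R_open_ball.
  - intros x _. destruct (exists_INR_ge (Rabs (f x - 0) + 1)) as [n Hn].
    exists (fun x => Rabs (f x - 0) < INR n). split; eauto. lra.
  - destruct (list_bound (fun A n => forall x, A x -> Rabs (f x) <= INR n) l) as [n Hn].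
    + intros A n m H Hm x Ax. specialize (H x Ax). apply le_INR in Hm. lra.
    + intros A HA. destruct (A1 A HA) as [n ->]. exists n. intros x Hx.
      rewrite Rminus_0_r in Hx. lra.
    + exists (INR n). split; [apply pos_INR|]. intros x Kx.
      destruct (B1 x Kx) as [A [HA Ax]]. eauto.
Qed.

(** The bound [N] allows an initial segment, which may leave a given open set, to be discarded. *)
Lemma compact_convergent_sequence {T : Type} (t : topology T) (a : T) (s : nat -> T) :
  (forall V, open t V -> V a -> exists n, forall j, (n <= j)%nat -> V (s j)) ->
  forall N, compact t (fun x => x = a \/ exists j, (N <= j)%nat /\ x = s j).
Proof.
  intros Hs N G HG Hc.
  destruct (Hc a) as [V [GV Va]]; [auto|].
  destruct (Hs V (HG V GV) Va) as [n Hn].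
  assert (Hfin : forall k, exists l, (forall A, In A l -> G A) /\
            forall j, (N <= j)%nat -> (j < k)%nat -> exists A, In A l /\ A (s j)).
  { induction k as [|k [l [H1 H2]]].
    - exists nil. split; [intros A []|]. intros; lia.
    - destruct (le_lt_dec N k) as [Hk|Hk].
      + destruct (Hc (s k)) as [A [GA As]]; [right; eauto|].
        exists (A :: l). split.
        * intros B [<-|HB]; auto.
        * intros j Hj1 Hj2. destruct (Nat.eq_dec j k) as [->|Hne].
          -- exists A. split; [left|]; auto.
          -- destruct (H2 j) as [B [? ?]]; [auto|lia|]. exists B. split; [right|]; auto.
      + exists l. split; auto. intros; lia. }
  destruct (Hfin n) as [l [H1 H2]].
  exists (V :: l). split.
  - intros A [<-|HA]; auto.
  - intros x [->|[j [Hj ->]]].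
    + exists V. split; [left|]; auto.
    + destruct (le_lt_dec n j) as [Hnj|Hnj].
      * exists V. split; [left|]; auto.
      * destruct (H2 j Hj Hnj) as [A [? ?]]. exists A. split; [right|]; auto.
Qed.

(** * Continuous functions *)

Local Notation ev f := (proj1_sig f).

Section ContinuousFunctions.
Context {X : Type} (tX : topology X).
Local Notation C := (CX tX).

Lemma CX_ext (f g : C) : (forall x, ev f x = ev g x) -> f = g.
Proof.
  intros H. destruct f as [f Hf], g as [g Hg]. simpl in H.
  assert (f = g) as -> by (apply functional_extensionality; auto).
  f_equal. apply proof_irrelevance.
Qed.

Lemma cont_const (a : R) : continuous tX R_top (fun _ => a).
Proof.
  apply pointwise_continuous_R. intros x e He. exists (fun _ => True).
  split; [apply open_full|split; auto]. intros. rewrite Rminus_diag, Rabs_R0. auto.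
Qed.

(** One estimate serves [Rmax], [Rmin] and the tents, the latter ignoring the second argument. *)
Lemma cont_lipschitz (op : R -> R -> R) (f g : X -> R) :
  (forall a b a' b', Rabs (op a b - op a' b') <= Rabs (a - a') + Rabs (b - b')) ->
  continuous tX R_top f -> continuous tX R_top g ->
  continuous tX R_top (fun x => op (f x) (g x)).
Proof.
  intros Hop Hf Hg. apply pointwise_continuous_R. intros x e He.
  destruct (continuous_R_pointwise tX f Hf x (e/2)) as [V1 [O1 [V1x H1]]]; [lra|].
  destruct (continuous_R_pointwise tX g Hg x (e/2)) as [V2 [O2 [V2x H2]]]; [lra|].
  exists (fun y => V1 y /\ V2 y). split; [apply open_inter; auto|split; auto].
  intros y [Hy1 Hy2]. specialize (H1 y Hy1). specialize (H2 y Hy2).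
  pose proof (Hop (f y) (g y) (f x) (g x)). lra.
Qed.

Lemma Rmax_lipschitz a b a' b' :
  Rabs (Rmax a b - Rmax a' b') <= Rabs (a - a') + Rabs (b - b').
Proof.
  unfold Rmax; repeat destruct Rle_dec; unfold Rabs; repeat destruct Rcase_abs; lra.
Qed.

Lemma Rmin_lipschitz a b a' b' :
  Rabs (Rmin a b - Rmin a' b') <= Rabs (a - a') + Rabs (b - b').
Proof.
  unfold Rmin; repeat destruct Rle_dec; unfold Rabs; repeat destruct Rcase_abs; lra.
Qed.

Definition cconst (a : R) : C := exist _ (fun _ => a) (cont_const a).
Definition cmax (f g : C) : C :=
  exist _ _ (cont_lipschitz Rmax _ _ Rmax_lipschitz (proj2_sig f) (proj2_sig g)).
Definition cmin (f g : C) : C :=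
  exist _ _ (cont_lipschitz Rmin _ _ Rmin_lipschitz (proj2_sig f) (proj2_sig g)).
Definition cabs (f : C) : C := cmax f (cscal tX (-1) f).
(** Truncation of [g] to the order interval [-a, a], meant for [a >= 0]. *)
Definition cclamp (a g : C) : C := cmax (cscal tX (-1) a) (cmin g a).

Lemma ev_cabs (f : C) x : ev (cabs f) x = Rabs (ev f x).
Proof. simpl. unfold Rmax, Rabs. destruct Rle_dec, Rcase_abs; lra. Qed.

Lemma cclamp_bound (a g : C) x : 0 <= ev a x -> Rabs (ev (cclamp a g) x) <= ev a x.
Proof.
  intros H. simpl. unfold Rmax, Rmin, Rabs.
  repeat destruct Rle_dec; repeat destruct Rcase_abs; lra.
Qed.

Lemma cclamp_id (a g : C) x : Rabs (ev g x) <= ev a x -> ev (cclamp a g) x = ev g x.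
Proof.
  intros H. simpl. revert H. unfold Rmax, Rmin, Rabs.
  repeat destruct Rle_dec; repeat destruct Rcase_abs; lra.
Qed.

Lemma cclamp_abs_le (a g : C) x :
  0 <= ev a x -> Rabs (ev (cclamp a g) x) <= Rabs (ev g x).
Proof.
  intros H. simpl. unfold Rmax, Rmin, Rabs.
  repeat destruct Rle_dec; repeat destruct Rcase_abs; lra.
Qed.

Lemma cclamp_rest_bound (a b g : C) x : 0 <= ev a x -> 0 <= ev b x ->
  Rabs (ev g x) <= ev a x + ev b x -> Rabs (ev (csub tX g (cclamp a g)) x) <= ev b x.
Proof.
  intros Ha Hb H. simpl. revert H. unfold Rmax, Rmin, Rabs.
  repeat destruct Rle_dec; repeat destruct Rcase_abs; lra.
Qed.

Lemma open_gt (f : C) (a : R) : open tX (fun x => a < ev f x).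
Proof. apply (proj2_sig f (fun y => a < y)). apply R_open_gt. Qed.

Lemma open_lt (f : C) (a : R) : open tX (fun x => ev f x < a).
Proof.
  apply open_ext with (2 := open_gt (cscal tX (-1) f) (- a)).
  intros x; simpl; split; lra.
Qed.

(** * Functionals dominated by the supremum over a compact set *)

(** Quantifying over bounds [s] avoids the supremum of |g| over [K] and covers empty [K]. *)
Definition dominated (K : X -> Prop) (c : R) (phi : C -> R) : Prop :=
  linear_functional tX phi /\ 0 <= c /\
  forall g s, 0 <= s -> (forall x, K x -> Rabs (ev g x) <= s) -> Rabs (phi g) <= c * s.

Lemma linear_zero phi : linear_functional tX phi -> phi (czero tX) = 0.
Proof.
  intros [_ H]. replace (czero tX) with (cscal tX 0 (czero tX)).
  - rewrite H. ring.
  - apply CX_ext. intros x; simpl; ring.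
Qed.

Lemma linear_sub phi f g : linear_functional tX phi ->
  phi (csub tX f g) = phi f - phi g.
Proof. intros [H1 H2]. unfold csub. rewrite H1, H2. ring. Qed.

Lemma dominated_subset K L c phi :
  (forall x, K x -> L x) -> dominated K c phi -> dominated L c phi.
Proof. intros HKL [H1 [H2 H3]]. split; [|split]; auto. Qed.

Lemma dominated_agree K c phi f g : dominated K c phi ->
  (forall x, K x -> ev f x = ev g x) -> phi f = phi g.
Proof.
  intros [Hl [Hc Hd]] H.
  assert (Rabs (phi (csub tX f g)) <= c * 0).
  { apply Hd; [lra|]. intros x Kx. simpl. rewrite (H x Kx).
    replace (ev g x + -1 * ev g x) with 0 by ring. rewrite Rabs_R0. lra. }
  rewrite linear_sub in H0 by auto. pose proof (Rabs_pos (phi f - phi g)).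
  assert (E : Rabs (phi f - phi g) = 0) by lra.
  destruct (Req_dec (phi f - phi g) 0) as [|N]; [lra|].
  apply Rabs_no_R0 in N. lra.
Qed.

(** * Variation of a dominated functional and dominated convergence *)

Section Variation.
Variables (K : X -> Prop) (c : R) (phi : C -> R).
Hypothesis HK : compact tX K.
Hypothesis Hphi : dominated K c phi.

Definition below (f : C) (r : R) : Prop :=
  exists g, r = phi g /\ forall x, Rabs (ev g x) <= Rabs (ev f x).

Lemma below_bounded f : bound (below f).
Proof.
  destruct (continuous_compact_bounded tX K (ev f) HK (proj2_sig f)) as [m [Hm0 Hm]].
  exists (c * m). intros r [g [-> Hg]].
  apply Rle_trans with (1 := Rle_abs _). apply Hphi; auto.
  intros x Kx. specialize (Hg x). specialize (Hm x Kx). lra.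
Qed.

Lemma below_nonempty f : exists r, below f r.
Proof.
  exists (phi (czero tX)), (czero tX). split; auto. intros x; simpl.
  rewrite Rabs_R0. apply Rabs_pos.
Qed.

(** This supremum is the value at |f| of the modulus of [phi] in the order dual: the integral of |f|
    against the total variation. *)
Definition variation (f : C) : R :=
  proj1_sig (completeness _ (below_bounded f) (below_nonempty f)).

Lemma variation_lub f : is_lub (below f) (variation f).
Proof. unfold variation. destruct completeness; auto. Qed.

Lemma variation_mono f g :
  (forall x, Rabs (ev f x) <= Rabs (ev g x)) -> variation f <= variation g.
Proof.
  intros H. apply variation_lub. intros r [h [-> Hh]]. apply variation_lub.
  exists h. split; auto. intros x. specialize (H x). specialize (Hh x). lra.
Qed.

Lemma abs_le_variation f : Rabs (phi f) <= variation f.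
Proof.
  destruct Hphi as [[_ Hs] _].
  unfold Rabs. destruct Rcase_abs.
  - replace (- phi f) with (phi (cscal tX (-1) f)) by (rewrite Hs; ring).
    apply variation_lub. eexists; split; eauto. intros x; simpl.
    replace (-1 * ev f x) with (- ev f x) by ring. rewrite Rabs_Ropp. lra.
  - apply variation_lub. exists f. split; auto. intros; lra.
Qed.

Lemma variation_dominated f s : 0 <= s -> (forall x, K x -> Rabs (ev f x) <= s) ->
  variation f <= c * s.
Proof.
  intros Hs H. apply variation_lub. intros r [g [-> Hg]].
  apply Rle_trans with (1 := Rle_abs _). apply Hphi; auto.
  intros x Kx. specialize (Hg x). specialize (H x Kx). lra.
Qed.

(** If |h| <= f and |k| <= g then |h + k| <= f + g, so competitors add up; the two suprema are then
    taken one after the other. *)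
Lemma variation_superadd f g : (forall x, 0 <= ev f x) -> (forall x, 0 <= ev g x) ->
  variation f + variation g <= variation (cadd tX f g).
Proof.
  intros Hf Hg.
  assert (H : forall a b, below f a -> below g b -> a + b <= variation (cadd tX f g)).
  { intros a b [h [-> Hh]] [k [-> Hk]]. destruct Hphi as [[Ha _] _]. rewrite <- Ha.
    apply variation_lub. eexists; split; eauto. intros x; simpl.
    specialize (Hh x); specialize (Hk x); specialize (Hf x); specialize (Hg x).
    rewrite (Rabs_pos_eq (ev f x + ev g x)) by lra.
    rewrite (Rabs_pos_eq (ev f x)) in Hh by auto.
    rewrite (Rabs_pos_eq (ev g x)) in Hk by auto.
    apply Rle_trans with (1 := Rabs_triang _ _). lra. }
  assert (variation f <= variation (cadd tX f g) - variation g).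
  { apply variation_lub. intros a Ha.
    assert (variation g <= variation (cadd tX f g) - a).
    { apply variation_lub. intros b Hb. specialize (H a b Ha Hb). lra. }
    lra. }
  lra.
Qed.

(* Riesz decomposition: a function bounded by [f + g] splits by clamping it at [f]. *)
Lemma variation_subadd f g : (forall x, 0 <= ev f x) -> (forall x, 0 <= ev g x) ->
  variation (cadd tX f g) <= variation f + variation g.
Proof.
  intros Hf Hg. apply variation_lub. intros r [h [-> Hh]].
  assert (E : phi h = phi (cclamp f h) + phi (csub tX h (cclamp f h))).
  { rewrite linear_sub by apply Hphi. ring. }
  rewrite E. apply Rplus_le_compat.
  - apply variation_lub. eexists; split; eauto. intros x.
    rewrite (Rabs_pos_eq (ev f x)) by auto. apply cclamp_bound; auto.
  - apply variation_lub. eexists; split; eauto. intros x.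
    rewrite (Rabs_pos_eq (ev g x)) by auto. apply cclamp_rest_bound; auto.
    specialize (Hh x). simpl in Hh. specialize (Hf x); specialize (Hg x).
    rewrite (Rabs_pos_eq (ev f x + ev g x)) in Hh by lra. auto.
Qed.

(** Maximum and minimum add up to [f + g], so superadditivity and subadditivity combine. *)
Lemma variation_modular f g : (forall x, 0 <= ev f x) -> (forall x, 0 <= ev g x) ->
  variation f + variation g <= variation (cmax f g) + variation (cmin f g).
Proof.
  intros Hf Hg. apply Rle_trans with (1 := variation_superadd f g Hf Hg).
  replace (cadd tX f g) with (cadd tX (cmax f g) (cmin f g)).
  - apply variation_subadd; intros x; simpl; specialize (Hf x); specialize (Hg x).
    + unfold Rmax; destruct Rle_dec; auto.
    + unfold Rmin; destruct Rle_dec; auto.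
  - apply CX_ext. intros x; simpl. unfold Rmax, Rmin; destruct Rle_dec; lra.
Qed.

Fixpoint tail_max (F : nat -> C) (n k : nat) : C :=
  match k with
  | O => F n
  | S k => cmax (tail_max F n k) (F (n + S k)%nat)
  end.

Lemma tail_max_ge F n k j x : (n <= j <= n + k)%nat ->
  ev (F j) x <= ev (tail_max F n k) x.
Proof.
  induction k as [|k IH]; intros Hj.
  - replace j with n by lia. simpl. lra.
  - simpl. destruct (Nat.eq_dec j (n + S k)) as [->|Hne]; [apply Rmax_r|].
    eapply Rle_trans; [apply IH; lia|]. apply Rmax_l.
Qed.

Lemma tail_max_le F n k x b : (forall j, (n <= j <= n + k)%nat -> ev (F j) x <= b) ->
  ev (tail_max F n k) x <= b.
Proof.
  induction k as [|k IH]; intros H; simpl.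
  - apply H; lia.
  - apply Rmax_lub; [apply IH; intros; apply H; lia|apply H; lia].
Qed.

Fixpoint running_min (F : nat -> C) (n : nat) : C :=
  match n with
  | O => F O
  | S n => cmin (running_min F n) (F (S n))
  end.

Lemma running_min_le F n j x : (j <= n)%nat -> ev (running_min F n) x <= ev (F j) x.
Proof.
  induction n as [|n IH]; intros Hj; simpl.
  - replace j with O by lia. lra.
  - destruct (Nat.eq_dec j (S n)) as [->|Hne]; [apply Rmin_r|].
    eapply Rle_trans; [apply Rmin_l|]. apply IH; lia.
Qed.

Lemma running_min_ge F n x b : (forall j, (j <= n)%nat -> b <= ev (F j) x) ->
  b <= ev (running_min F n) x.
Proof.
  induction n as [|n IH]; intros H; simpl; [apply H; lia|].
  apply Rmin_glb; [apply IH; intros; apply H; lia|apply H; lia].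
Qed.

(** The open sets where [H n] is below [e] increase with [n] and cover [K], so one of them contains
    [K]. *)
Lemma dini (H : nat -> C) (e : R) : 0 < e ->
  (forall n x, ev (H (S n)) x <= ev (H n) x) ->
  (forall x, exists n, ev (H n) x < e) ->
  exists n, forall x, K x -> ev (H n) x < e.
Proof.
  intros He Hdec Hlim.
  assert (Hmono : forall x n m, (n <= m)%nat -> ev (H m) x <= ev (H n) x).
  { intros x n m Hnm. induction Hnm; [lra|]. specialize (Hdec m x). lra. }
  destruct (HK (fun A => exists n, A = (fun x => ev (H n) x < e))) as [l [H1 H2]].
  - intros A [n ->]. apply open_lt.
  - intros x _. destruct (Hlim x) as [n Hn]. exists (fun x => ev (H n) x < e). eauto.
  - destruct (list_bound (fun A n => forall x, A x -> ev (H n) x < e) l) as [n Hn].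
    + intros A n m HA Hnm x Ax. specialize (HA x Ax). specialize (Hmono x n m Hnm). lra.
    + intros A HA. destruct (H1 A HA) as [n ->]. exists n. auto.
    + exists n. intros x Kx. destruct (H2 x Kx) as [A [HA Ax]]. eauto.
Qed.

(** Accumulated losses from choosing block lengths below; they stay under 1. *)
Fixpoint half_powers_sum (n : nat) : R :=
  match n with O => 1 / 2 | S n => half_powers_sum n + (1 / 2) ^ (S (S n)) end.

Lemma half_powers_sum_eq n : half_powers_sum n = 1 - (1 / 2) ^ (S n).
Proof. induction n as [|n IH]; simpl in *; [lra|]. rewrite IH. simpl. lra. Qed.

(* Dominated convergence without measures. Maxima of long blocks of [|f_j|] starting at [n]
   nearly realise the supremum of their variations; by modularity the successive minima of
   these block maxima keep a large variation, although they decrease to 0 pointwise, hence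
   uniformly on [K] by Dini's theorem. *)
Theorem dominated_convergence (f : nat -> C) (m : R) :
  (forall j x, Rabs (ev (f j) x) <= m) ->
  (forall x e, 0 < e -> exists n, forall j, (n <= j)%nat -> Rabs (ev (f j) x) < e) ->
  forall e, 0 < e -> exists n, forall j, (n <= j)%nat -> Rabs (phi (f j)) < e.
Proof.
  intros Hm Hnull e He. apply NNPP. intros Hnot.
  assert (Hbad : forall n, exists j, (n <= j)%nat /\ e <= Rabs (phi (f j))).
  { intros n. apply NNPP. intros Hn. apply Hnot. exists n. intros j Hj.
    apply Rnot_le_lt. intros Hle. apply Hn. eauto. }
  set (F := fun j => cabs (f j)).
  assert (HF0 : forall j x, 0 <= ev (F j) x).
  { intros. unfold F. rewrite ev_cabs. apply Rabs_pos. }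
  assert (HT0 : forall n k x, 0 <= ev (tail_max F n k) x).
  { intros. eapply Rle_trans; [apply (HF0 n x)|]. apply tail_max_ge. lia. }
  assert (Hvm : forall g h, (forall x, 0 <= ev g x) -> (forall x, ev g x <= ev h x) ->
                variation g <= variation h).
  { intros g h Hg Hgh. apply variation_mono. intros x.
    specialize (Hg x). specialize (Hgh x). rewrite !Rabs_pos_eq; lra. }
  (* [s n] is the supremum of the variations of all blocks starting at [n]; it is at least [e]
     because some block reaches a bad index. *)
  assert (Hsup : forall n, exists s, is_lub (fun r => exists k, r = variation (tail_max F n k)) s).
  { intros n. destruct (completeness (fun r => exists k, r = variation (tail_max F n k)))
      as [s Hs]; [| |exists s; auto].
    - exists (c * Rabs m). intros r [k ->]. apply variation_dominated; [apply Rabs_pos|].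
      intros x _. rewrite Rabs_pos_eq by auto. apply tail_max_le. intros j _.
      unfold F. rewrite ev_cabs. eapply Rle_trans; [apply Hm|apply Rle_abs].
    - exists (variation (tail_max F n 0)). eauto. }
  apply choice_fun in Hsup. destruct Hsup as [s Hs].
  assert (Hs_e : forall n, e <= s n).
  { intros n. destruct (Hbad n) as [j [Hj Hej]].
    apply Rle_trans with (1 := Hej). apply Rle_trans with (1 := abs_le_variation _).
    apply Rle_trans with (variation (tail_max F n (j - n))).
    - apply variation_mono. intros x. rewrite (Rabs_pos_eq (ev (tail_max _ _ _) x)) by auto.
      rewrite <- ev_cabs. apply (tail_max_ge F). lia.
    - apply Hs. eauto. }
  assert (Hk : forall n, exists k,
    s n - e / 2 * (1 / 2) ^ (S n) <= variation (tail_max F n k)).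
  { intros n. apply NNPP. intros Hn.
    assert (0 < e / 2 * (1 / 2) ^ (S n)).
    { apply Rmult_lt_0_compat; [lra|]. apply pow_lt. lra. }
    assert (s n <= s n - e / 2 * (1 / 2) ^ (S n)); [|lra].
    apply Hs. intros r [k ->]. apply Rnot_lt_le. intros Hlt. apply Hn. exists k. lra. }
  apply choice_fun in Hk. destruct Hk as [k Hk].
  set (h := fun n => tail_max F n (k n)).
  set (H := running_min h).
  assert (HH0 : forall n x, 0 <= ev (H n) x).
  { intros. apply running_min_ge. intros; apply HT0. }
  assert (HHv : forall n, s n - e / 2 * half_powers_sum n <= variation (H n)).
  { induction n as [|n IH].
    - specialize (Hk O). unfold H; simpl. simpl in Hk. unfold h. lra.
    - pose proof (variation_modular (H n) (h (S n)) (HH0 n) (HT0 _ _)) as Hmod.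
      (* This maximum lies below one longer block starting at [n]; with modularity, passing to the
         next minimum costs only the loss in the choice of [h (S n)]. *)
      assert (variation (cmax (H n) (h (S n))) <= s n).
      { apply Rle_trans with (variation (tail_max F n (S (k n + k (S n))))).
        - apply Hvm.
          + intros x. eapply Rle_trans; [apply (HH0 n x)|]. apply Rmax_l.
          + intros x. apply Rmax_lub.
            * eapply Rle_trans; [apply (running_min_le h n n x); lia|].
              apply tail_max_le. intros; apply tail_max_ge; lia.
            * apply tail_max_le. intros; apply tail_max_ge; lia.
        - apply Hs. eauto. }
      specialize (Hk (S n)). fold (h (S n)) in Hk.
      change (H (S n)) with (cmin (H n) (h (S n))).
      cbn [half_powers_sum]. lra. }
  assert (Hlow : forall n, e / 2 <= variation (H n)).
  { intros n. specialize (HHv n). specialize (Hs_e n).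
    rewrite half_powers_sum_eq in HHv.
    assert (0 < (1 / 2) ^ (S n)) by (apply pow_lt; lra). nra. }
  assert (Hc : 0 <= c) by apply Hphi.
  (* Chosen so that [c * d <= e / 4], below the lower bound [e / 2] for the variations. *)
  set (d := e / 4 / (c + 1)).
  assert (Hd : 0 < d) by (apply Rdiv_lt_0_compat; lra).
  destruct (dini H d Hd) as [n Hn].
  - intros n x. apply Rmin_l.
  - intros x. destruct (Hnull x (d / 2)) as [n Hn]; [lra|].
    exists n. apply Rle_lt_trans with (d / 2); [|lra].
    eapply Rle_trans; [apply (running_min_le h n n x); lia|].
    apply tail_max_le. intros j Hj. unfold F. rewrite ev_cabs. left. apply Hn. lia.
  - assert (variation (H n) <= c * d).
    { apply variation_dominated; [lra|]. intros x Kx. rewrite Rabs_pos_eq by auto.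
      left; auto. }
    assert (c * d <= e / 4).
    { unfold d. replace (c * (e / 4 / (c + 1))) with (e / 4 * (c / (c + 1))) by (field; lra).
      assert (c / (c + 1) <= 1).
      { apply Rmult_le_reg_r with (c + 1); [lra|]. unfold Rdiv.
        rewrite Rmult_assoc, Rinv_l by lra. lra. }
      nra. }
    specialize (Hlow n). lra.
Qed.

End Variation.
End ContinuousFunctions.

Arguments cconst {X tX}.
Arguments cmax {X tX}.
Arguments cmin {X tX}.
Arguments cabs {X tX}.
Arguments cclamp {X tX}.

(** * The compact-open and the weak topology *)

Section FunctionSpace.
Context {X : Type} (tX : topology X).
Local Notation C := (CX tX).

(** Finitely many subbasic conditions merge into one: unite their compact sets and take the least
    radius. *)
Lemma Cc_nbhd_zero (W : C -> Prop) : open (Cc tX) W -> W (czero tX) ->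
  exists K e, compact tX K /\ 0 < e /\
    forall g, (forall x, K x -> Rabs (ev g x) < e) -> W g.
Proof.
  intros HW W0. destruct (HW _ W0) as [l [H1 H2]].
  assert (H : exists K e, compact tX K /\ 0 < e /\
    forall g, (forall x, K x -> Rabs (ev g x) < e) -> forall B, In B l -> B g).
  { clear H2. induction l as [|B l IH].
    - exists (fun _ => False), 1. split; [apply compact_empty|]. split; [lra|].
      intros g _ B [].
    - destruct IH as [K [e [HK [He H]]]]. { intros; apply H1; right; auto. }
      destruct (H1 B) as [[K' [U [HK' [HU E]]]] B0]; [left; auto|]. subst B.
      assert (He' : exists e', 0 < e' /\ forall x, K' x -> forall y, Rabs y < e' -> U y).
      { destruct (classic (exists x, K' x)) as [[x Hx]|Hn].
        - specialize (B0 x Hx). simpl in B0. destruct (HU 0 B0) as [e' [He' H']].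
          exists e'. split; auto. intros _ _ y Hy. apply H'. rewrite Rminus_0_r. auto.
        (* On an empty [K'] the condition is void and [U] may miss 0, so any radius serves. *)
        - exists 1. split; [lra|]. intros x Hx. exfalso; eauto. }
      destruct He' as [e' [He' H']].
      exists (fun x => K x \/ K' x), (Rmin e e').
      split; [apply compact_union; auto|]. split; [apply Rmin_pos; auto|].
      intros g Hg B [<-|HB].
      + intros x Hx. apply (H' x Hx). eapply Rlt_le_trans; [apply Hg; auto|apply Rmin_r].
      + apply H; auto. intros x Hx.
        eapply Rlt_le_trans; [apply Hg; auto|apply Rmin_l]. }
  destruct H as [K [e [HK [He H]]]]. exists K, e. split; [|split]; auto.
  intros g Hg. apply H2. apply H. auto.
Qed.

Lemma continuous_functional_dominated (phi : C -> R) :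
  linear_functional tX phi -> continuous (Cc tX) R_top phi ->
  exists K c, compact tX K /\ dominated tX K c phi.
Proof.
  intros Hl Hc.
  destruct (Cc_nbhd_zero (fun g => Rabs (phi g - 0) < 1)) as [K [e [HK [He H]]]].
  - apply (Hc (fun y => Rabs (y - 0) < 1)). apply R_open_ball.
  - rewrite linear_zero, Rminus_0_r, Rabs_R0 by auto. lra.
  - assert (Hpos : 0 < 2 / e) by (apply Rdiv_lt_0_compat; lra).
    exists K, (2 / e). split; auto. split; auto. split; [lra|].
    intros g s Hs Hg. apply le_epsilon. intros eps Heps.
    (* This slack gives [/ a = 2 / e * s + eps] and keeps the scale [a] meaningful when [s = 0]. *)
    set (d := eps * e / 2).
    assert (Hd : 0 < d).
    { unfold d. apply Rmult_lt_0_compat; [|lra]. apply Rmult_lt_0_compat; lra. }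
    set (a := e / (2 * (s + d))).
    assert (Ha : 0 < a) by (apply Rdiv_lt_0_compat; lra).
    assert (Hag : Rabs (phi (cscal tX a g) - 0) < 1).
    { apply H. intros x Kx. simpl. rewrite Rabs_mult, (Rabs_pos_eq a) by lra.
      apply Rle_lt_trans with (a * s).
      - apply Rmult_le_compat_l; [lra|auto].
      - apply Rlt_le_trans with (a * (2 * (s + d))).
        + apply Rmult_lt_compat_l; lra.
        + unfold a. right. field. lra. }
    rewrite Rminus_0_r in Hag. destruct Hl as [_ Hl]. rewrite Hl in Hag.
    rewrite Rabs_mult, (Rabs_pos_eq a) in Hag by lra.
    replace (2 / e * s + eps) with (/ a) by (unfold a, d; field; unfold d in Hd; nra).
    apply Rmult_le_reg_l with a; auto. rewrite Rinv_r by lra. lra.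
Qed.

(** [K] is cut into finitely many compact pieces on which [f] stays within [d / 4] of some value
    [f x]; keeping [g] within [d / 2] of that value on each piece is an open condition. *)
Lemma Cc_uniform_nbhd (f : C) (K : X -> Prop) (d : R) : compact tX K -> 0 < d ->
  exists W, open (Cc tX) W /\ W f /\
    forall g, W g -> forall x, K x -> Rabs (ev g x - ev f x) < d.
Proof.
  intros HK Hd.
  destruct (HK (fun A => exists x, A = (fun y => Rabs (ev f y - ev f x) < d / 4)))
    as [l [H1 H2]].
  - intros A [x ->]. apply (proj2_sig f (fun r => Rabs (r - ev f x) < d / 4)).
    apply R_open_ball.
  - intros x _. eexists; split; [exists x; reflexivity|]. simpl.
    rewrite Rminus_diag, Rabs_R0. lra.
  - destruct (list_choice _ l H1) as [p [P1 P2]].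
    set (K' := fun x y => K y /\ Rabs (ev f y - ev f x) <= d / 4).
    exists (fun g => forall x, In x p -> forall y, K' x y -> Rabs (ev g y - ev f x) < d / 2).
    split; [|split].
    + apply open_list_inter with
        (B := fun x (g : C) => forall y, K' x y -> Rabs (ev g y - ev f x) < d / 2).
      intros x _. apply gen_open_subbasic.
      exists (K' x), (fun r => Rabs (r - ev f x) < d / 2). split; [|split; auto].
      * apply compact_closed_inter; auto. unfold closed.
        apply open_ext with (A := fun y => d / 4 < Rabs (ev f y - ev f x)).
        { intros y. split; [apply Rlt_not_le|apply Rnot_le_lt]. }
        apply (proj2_sig f (fun r => d / 4 < Rabs (r - ev f x))).
        apply R_open_outside_ball.
      * apply R_open_ball.
    + intros x _ y [_ Hy]. lra.
    + intros g Hg y Ky. destruct (H2 y Ky) as [A [HA Ay]].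
      destruct (P1 A HA) as [x [Hx ->]].
      assert (Hgy : Rabs (ev g y - ev f x) < d / 2).
      { apply Hg; auto. split; auto. lra. }
      pose proof (Rabs_triang (ev g y - ev f x) (ev f x - ev f y)) as Ht.
      rewrite (Rabs_minus_sym (ev f x)) in Ht.
      replace (ev g y - ev f x + (ev f x - ev f y)) with (ev g y - ev f y) in Ht by ring.
      lra.
Qed.

Lemma dominated_continuous (K : X -> Prop) (c : R) (phi : C -> R) :
  compact tX K -> dominated tX K c phi -> continuous (Cc tX) R_top phi.
Proof.
  intros HK [Hl [Hc Hd]]. apply pointwise_continuous_R. intros f e He.
  assert (Hd0 : 0 < e / (c + 1)) by (apply Rdiv_lt_0_compat; lra).
  destruct (Cc_uniform_nbhd f K (e / (c + 1)) HK Hd0) as [W [HW [Wf H]]].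
  exists W. split; [|split]; auto. intros g Wg.
  rewrite <- linear_sub by auto.
  assert (Rabs (phi (csub tX g f)) <= c * (e / (c + 1))).
  { apply Hd; [lra|]. intros x Kx. simpl.
    replace (ev g x + -1 * ev f x) with (ev g x - ev f x) by ring. left. apply H; auto. }
  assert (c * (e / (c + 1)) = e - e / (c + 1)) by (field; lra). lra.
Qed.

Lemma weak_preimage_open (K : X -> Prop) (c : R) (phi : C -> R) (U : R -> Prop) :
  compact tX K -> dominated tX K c phi -> R_open U ->
  open (Cc_weak tX) (fun f => U (phi f)).
Proof.
  intros HK Hphi HU. apply gen_open_subbasic. exists phi, U.
  split; [apply Hphi|]. split; [eapply dominated_continuous; eauto|]. auto.
Qed.

Lemma dominated_eval (x : X) : dominated tX (fun y => In y (x :: nil)) 1 (fun f => ev f x).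
Proof.
  split; [split; intros; reflexivity|]. split; [lra|]. intros g s _ H.
  rewrite Rmult_1_l. apply H. left; auto.
Qed.

Lemma weak_eval_open (x : X) (U : R -> Prop) : R_open U ->
  open (Cc_weak tX) (fun f => U (ev f x)).
Proof.
  apply weak_preimage_open with (2 := dominated_eval x). apply compact_list.
Qed.

(** A basic weak neighbourhood involves finitely many functionals, each dominated on some compact
    set, so dominated convergence applies. *)
Lemma bounded_null_weakly_null (f : nat -> C) (m : R) :
  (forall j x, Rabs (ev (f j) x) <= m) ->
  (forall x e, 0 < e -> exists n, forall j, (n <= j)%nat -> Rabs (ev (f j) x) < e) ->
  forall V, open (Cc_weak tX) V -> V (czero tX) ->
    exists n, forall j, (n <= j)%nat -> V (f j).
Proof.
  intros Hm Hnull V HV V0. destruct (HV _ V0) as [l [H1 H2]].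
  destruct (list_bound (fun (B : C -> Prop) n => forall j, (n <= j)%nat -> B (f j)) l)
    as [n Hn].
  - intros B n n' H Hnn j Hj. apply H. lia.
  - intros B HB. destruct (H1 B HB) as [[phi [U [Hl [Hc [HU E]]]]] B0]. subst B.
    rewrite linear_zero in B0 by auto. destruct (HU 0 B0) as [e [He HeU]].
    destruct (continuous_functional_dominated phi Hl Hc) as [K [c [HK Hd]]].
    destruct (dominated_convergence tX K c phi HK Hd f m Hm Hnull e He) as [n Hn].
    exists n. intros j Hj. apply HeU. rewrite Rminus_0_r. auto.
  - exists n. intros j Hj. apply H2. intros B HB. apply Hn; auto.
Qed.

(** Outside a basic neighbourhood of [f] some functional differs from its value at [f] by at least
    [e]; differences below and above [e / 2] separate. The functionals are treated one at a time. *)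
Lemma weak_regular : regular (Cc_weak tX).
Proof.
  intros F f HF Ff. destruct (HF f Ff) as [l [H1 H2]].
  assert (H : forall l, (forall B, In B l -> weak_subbasis tX B /\ B f) ->
    exists U V, open (Cc_weak tX) U /\ open (Cc_weak tX) V /\ U f /\
      (forall g, (exists B, In B l /\ ~ B g) -> V g) /\ (forall g, ~ (U g /\ V g))).
  { clear. induction l as [|B l IH]; intros H1.
    - exists (fun _ => True), (fun _ => False). split; [apply open_full|].
      split; [apply open_locally; intros x []|]. split; auto. split; [|tauto].
      intros g [B [[] _]].
    - destruct IH as [U [V [HU [HV [Uf [HlV HUV]]]]]]. { intros; apply H1; right; auto. }
      destruct (H1 B) as [[phi [W [Hl [Hc [HW E]]]]] B0]; [left; auto|]. subst B.
      destruct (HW _ B0) as [e [He HeW]].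
      destruct (continuous_functional_dominated phi Hl Hc) as [K [c [HK Hd]]].
      exists (fun g => U g /\ Rabs (phi g - phi f) < e / 2).
      exists (fun g => exists A, (A = V \/ A = (fun g => e / 2 < Rabs (phi g - phi f))) /\ A g).
      split; [|split; [|split; [|split]]].
      + apply open_inter; auto.
        apply (weak_preimage_open K c phi (fun y => Rabs (y - phi f) < e / 2)); auto.
        apply R_open_ball.
      + apply open_union. intros A [->| ->]; auto.
        apply (weak_preimage_open K c phi (fun y => e / 2 < Rabs (y - phi f))); auto.
        apply R_open_outside_ball.
      + split; auto. rewrite Rminus_diag, Rabs_R0. lra.
      + intros g [B [[<-|HB] Bg]].
        * eexists; split; [right; reflexivity|]. simpl. apply Rnot_le_lt. intros Hle.
          apply Bg. apply HeW. lra.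
        * exists V. split; auto. apply HlV. eauto.
      + intros g [[Ug Hg] [A [[->| ->] Ag]]]; [apply (HUV g); auto|lra]. }
  destruct (H l H1) as [U [V [HU [HV [Uf [HlV HUV]]]]]].
  exists U, V. repeat (split; auto). intros g Fg. apply HlV. apply NNPP. intros Hn.
  apply (H2 g); auto. intros B HB. apply NNPP. intros HBg. apply Hn. eauto.
Qed.

(** * Separation of points from compact sets, and hemicompactness *)

Lemma tychonoff_separates_compact (K : X -> Prop) (x : X) :
  tychonoff tX -> compact tX K -> ~ K x ->
  exists f : C, ev f x = 1 /\ (forall y, K y -> ev f y = 0) /\
    forall y, Rabs (ev f y) <= 1.
Proof.
  intros [HT1 HCR] HK Kx.
  destruct (HK (fun A => exists g : C, ev g x = 0 /\ A = (fun y => / 2 < ev g y)))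
    as [l [H1 H2]].
  - intros A [g [_ ->]]. apply open_gt.
  - intros y Ky.
    destruct (HCR (fun z => z = y) x) as [g [Hg [Hgx Hgy]]].
    + apply open_locally. intros z Hz. destruct (HT1 z y Hz) as [V [HV [Vz Vy]]].
      exists V. split; [|split]; auto. intros w Vw ->. auto.
    + intros ->. auto.
    + exists (fun z => / 2 < g z). split; [|rewrite Hgy by auto; lra].
      exists (exist _ g Hg). auto.
  - assert (Hmax : exists g : C, ev g x = 0 /\
      forall A, In A l -> forall y, A y -> / 2 < ev g y).
    { clear H2. induction l as [|A l IH].
      - exists (czero tX). split; auto. intros A [].
      - destruct IH as [g [Hg Hl]]. { intros; apply H1; right; auto. }
        destruct (H1 A) as [g' [Hg' E]]; [left; auto|]. subst A.
        exists (cmax g g'). split.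
        + simpl. rewrite Hg, Hg'. apply Rmax_left. lra.
        + intros A [<-|HA] y Ay.
          * eapply Rlt_le_trans; [apply Ay|apply Rmax_r].
          * eapply Rlt_le_trans; [apply (Hl A HA y Ay)|apply Rmax_l]. }
    destruct Hmax as [g [Hgx Hg]].
    (* [g] vanishes at [x] and exceeds 1/2 on [K], so the truncation of [2 g] to [0, 1] is 0 at [x]
       and 1 on [K]. *)
    exists (csub tX (cconst 1) (cmax (cconst 0) (cmin (cconst 1) (cscal tX 2 g)))).
    split; [|split].
    + simpl. rewrite Hgx. unfold Rmax, Rmin. repeat destruct Rle_dec; lra.
    + intros y Ky. destruct (H2 y Ky) as [A [HA Ay]]. specialize (Hg A HA y Ay).
      simpl. unfold Rmax, Rmin. repeat destruct Rle_dec; lra.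
    + intros y. simpl. unfold Rmax, Rmin, Rabs.
      repeat destruct Rle_dec; destruct Rcase_abs; lra.
Qed.

(** Each ball of radius 1/(n+1) about 0 contains all functions small on some compact [K n]. For
    large [n], functions in the ball are below 1 on [L]; a point of [L] outside [K n] would give a
    function in the ball, zero on [K n], with value 1 at that point. *)
Lemma metrizable_hemicompact : tychonoff tX -> metrizable_Cc tX ->
  exists K : nat -> X -> Prop, (forall n, compact tX (K n)) /\
    (forall n m x, (n <= m)%nat -> K n x -> K m x) /\
    forall L, compact tX L -> exists n, forall x, L x -> K n x.
Proof.
  intros HX [d [Hd0 [Hsym [Htri Hopen]]]].
  assert (Hball : forall n, exists K e, compact tX K /\ 0 < e /\
    forall g, (forall x, K x -> Rabs (ev g x) < e) -> d (czero tX) g < / (INR n + 1)).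
  { intros n. destruct (Cc_nbhd_zero (fun g => d (czero tX) g < / (INR n + 1)))
      as [K [e H]].
    - apply Hopen. intros f Hf. exists (/ (INR n + 1) - d (czero tX) f).
      split; [lra|]. intros g Hg. specialize (Htri (czero tX) f g). lra.
    - rewrite (proj2 (Hd0 _ _)) by auto. apply inv_succ_pos.
    - exists K, e. auto. }
  apply choice_fun in Hball. destruct Hball as [K HK].
  apply choice_fun in HK. destruct HK as [e HK].
  exists (fun n x => exists i, (i <= n)%nat /\ K i x). split; [|split].
  - induction n as [|n IH].
    + rewrite (pred_ext _ (K O)); [apply HK|]. intros x. split.
      * intros [i [Hi Hx]]. replace i with O in Hx by lia. auto.
      * intros Hx. exists O. auto.
    + rewrite (pred_ext _ (fun x => (exists i, (i <= n)%nat /\ K i x) \/ K (S n) x)).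
      { apply compact_union; auto. apply HK. }
      intros x. split.
      * intros [i [Hi Hx]]. destruct (Nat.eq_dec i (S n)) as [->|]; auto.
        left. exists i. split; auto. lia.
      * intros [[i [Hi Hx]]|Hx]; [exists i|exists (S n)]; split; auto.
  - intros n m x Hnm [i [Hi Hx]]. exists i. split; auto. lia.
  - intros L HL.
    assert (HW : open (Cc tX) (fun g => forall x, L x -> Rabs (ev g x - 0) < 1)).
    { apply gen_open_subbasic. exists L, (fun y => Rabs (y - 0) < 1).
      split; auto. split; auto. apply R_open_ball. }
    destruct (proj1 (Hopen _) HW (czero tX)) as [r [Hr Hr']].
    { intros x _. simpl. rewrite Rminus_diag, Rabs_R0. lra. }
    destruct (exists_inv_succ_lt r Hr) as [n Hn]. exists n. intros x Lx.
    exists n. split; auto. apply NNPP. intros HKx.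
    destruct (HK n) as [HKn [Hen Hd]].
    destruct (tychonoff_separates_compact (K n) x HX HKn HKx) as [f [Hfx [HfK _]]].
    assert (Rabs (ev f x - 0) < 1).
    { apply (Hr' f); auto. apply Rlt_trans with (2 := Hn). apply Hd.
      intros y Ky. rewrite HfK by auto. rewrite Rabs_R0. auto. }
    rewrite Hfx, Rminus_0_r, Rabs_R1 in H. lra.
Qed.

End FunctionSpace.

(** * Weakly aleph implies countable *)

Section Countability.
Context {X : Type} (tX : topology X).
Local Notation C := (CX tX).

Definition bounded_null (f : nat -> C) : Prop :=
  (forall j x, Rabs (ev (f j) x) <= 1) /\
  forall x e, 0 < e -> exists n, forall j, (n <= j)%nat -> Rabs (ev (f j) x) < e.

Definition small_at (A : C -> Prop) (t : X) : Prop := forall g, A g -> Rabs (ev g t) < 1.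

Definition catches (A : nat -> C -> Prop) (t : X) (k : nat) (f : C) : Prop :=
  exists i, (i < k)%nat /\ A i f /\ small_at (A i) t.

(** What the countability argument retains of the k-network; [k] may depend on the sequence, but not
    on its terms. *)
Definition null_network (A : nat -> C -> Prop) : Prop :=
  forall t f, bounded_null f -> exists k n, forall j, (n <= j)%nat -> catches A t k (f j).

(* A neighbourhood of 0 meets only finitely many members of each locally finite layer, and a
   weakly null sequence is eventually in it; the members met that way are countably many. *)
Lemma weakly_aleph_null_network : weakly_aleph tX -> exists A, null_network A.
Proof.
  intros [_ [N [HN [Ns [HNs Hlf]]]]].
  assert (HV : forall n, exists p : (C -> Prop) * list (C -> Prop),
    open (Cc_weak tX) (fst p) /\ fst p (czero tX) /\
    forall A, Ns n A -> (exists y, A y /\ fst p y) -> In A (snd p)).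
  { intros n. destruct (Hlf n (czero tX)) as [V [HV [V0 [l Hl]]]]. exists (V, l). auto. }
  apply choice_fun in HV. destruct HV as [p Hp].
  (* A single enumeration of the finite lists of all layers; positions out of range give the empty
     set, which catches nothing. *)
  exists (fun c => nth (snd (Cantor.of_nat c)) (snd (p (fst (Cantor.of_nat c)))) (fun _ => False)).
  intros t f [Hf1 Hf0].
  pose proof (bounded_null_weakly_null tX f 1 Hf1 Hf0) as Hweak.
  destruct (Hf0 t 1) as [n0 Hn0]; [lra|].
  destruct (HN _ (fun g => Rabs (ev g t - 0) < 1)
              (compact_convergent_sequence _ _ f Hweak n0)) as [L [HL1 [HL2 HL3]]].
  { apply (weak_eval_open tX t (fun y => Rabs (y - 0) < 1)). apply R_open_ball. }
  { intros g [->|[j [Hj ->]]]; rewrite Rminus_0_r; auto. simpl. rewrite Rabs_R0. lra. }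
  (* Each [A] in the finite cover belongs to some layer; once [f j] is in the neighbourhood attached
     to that layer, a set [A] containing [f j] meets it and is therefore listed. *)
  assert (HLn : exists n, forall A, In A L -> forall j, (n <= j)%nat -> A (f j) ->
            exists m, In A (snd (p m))).
  { apply (list_bound (fun A n => forall j, (n <= j)%nat -> A (f j) -> exists m, In A (snd (p m)))).
    - intros A n m H Hnm j Hj. apply H. lia.
    - intros A HA. destruct (proj1 (HNs A) (HL1 A HA)) as [m Hm].
      destruct (Hp m) as [HVo [HV0 HVl]].
      destruct (Hweak _ HVo HV0) as [n Hn]. exists n. intros j Hj Aj. exists m.
      apply HVl; auto. exists (f j). auto. }
  destruct HLn as [n1 Hn1].
  destruct (list_bound (fun A k => (exists m, In A (snd (p m))) -> exists i, (i < k)%nat /\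
      nth (snd (Cantor.of_nat i)) (snd (p (fst (Cantor.of_nat i)))) (fun _ => False) = A) L)
    as [k Hk].
  - intros A k k' H Hkk HA. destruct (H HA) as [i [Hi E]]. exists i. split; auto. lia.
  - intros A _. destruct (classic (exists m, In A (snd (p m)))) as [[m Hm]|Hno].
    + destruct (In_nth _ _ (fun _ => False) Hm) as [q [_ Hq]].
      exists (S (Cantor.to_nat (m, q))). intros _. exists (Cantor.to_nat (m, q)).
      split; [lia|]. rewrite Cantor.cancel_of_to. auto.
    + exists O. intros; contradiction.
  - exists k, (Nat.max n0 n1). intros j Hj.
    destruct (HL2 (f j)) as [A [HA Aj]]; [right; exists j; split; auto; lia|].
    destruct (Hk A HA) as [i [Hi E]]; [apply (Hn1 A HA j); auto; lia|].
    exists i. unfold small_at. rewrite E. split; auto. split; auto.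
    intros g Ag. specialize (HL3 A HA g Ag). simpl in HL3.
    rewrite Rminus_0_r in HL3. auto.
Qed.

Lemma finite_trace (P : nat -> Prop) (k : nat) :
  exists s : list nat, forall i, (i < k)%nat -> (In i s <-> P i).
Proof.
  induction k as [|k [s Hs]]; [exists nil; intros; lia|].
  exists (if excluded_middle_informative (P k) then k :: s
          else filter (fun i => negb (i =? k)) s).
  intros i Hi. destruct (Nat.eq_dec i k) as [->|Hne].
  - destruct excluded_middle_informative; [split; [auto|left; auto]|].
    rewrite filter_In, Nat.eqb_refl. split; [intros [_ H]; discriminate|contradiction].
  - assert (Hik : (i < k)%nat) by lia. specialize (Hs i Hik).
    destruct excluded_middle_informative.
    + simpl. split; [intros [E|H]; [lia|tauto]|tauto].
    + rewrite filter_In. split; [tauto|]. intros H; split; [tauto|].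
      apply Bool.negb_true_iff, Nat.eqb_neq; auto.
Qed.

Lemma cont_tent (i : nat) (f : C) : continuous tX R_top (fun x => tent i (ev f x)).
Proof.
  apply cont_lipschitz with (op := fun a _ => tent i a) (g := ev f); [|apply proj2_sig..].
  intros a b a' b'. pose proof (tent_lipschitz i a a'). pose proof (Rabs_pos (b - b')). lra.
Qed.

(* The sets where these functions are positive form a countable base of the topology that
   the sequence [h] induces on [X]. *)
Fixpoint box (h : nat -> C) (l : list (nat * nat)) : C :=
  match l with
  | nil => cconst 1
  | (i, j) :: l => cmin (exist _ _ (cont_tent j (h i))) (box h l)
  end.

Lemma box_cons_pos h i j l x :
  0 < ev (box h ((i, j) :: l)) x <-> 0 < tent j (ev (h i) x) /\ 0 < ev (box h l) x.
Proof.
  simpl. split.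
  - intros H. split; eapply Rlt_le_trans; eauto; [apply Rmin_l|apply Rmin_r].
  - intros [H1 H2]. apply Rmin_glb_lt; auto.
Qed.

(** * Countability of X from a null network *)

Section NullNetwork.
Variable A : nat -> C -> Prop.
Hypothesis HA : null_network A.

(** One inclusion between traces suffices: a set that catches a function with respect to [t] then
    bounds it at [s] as well. *)
Definition inherits (k : nat) (t s : X) : Prop :=
  forall i, (i < k)%nat -> small_at (A i) t -> small_at (A i) s.

(** [h i] separates [s] from [t], so the box contains disjoint boxes around both: one carries the
    bump, the other leaves room around [t] for later bumps. *)
Lemma bump_off_point (h : nat -> C) (t s : X) (l : list (nat * nat)) (i : nat) :
  0 < ev (box h l) t -> 0 < ev (box h l) s -> ev (h i) s <> ev (h i) t ->
  exists (f : C) l', ev f s = 1 /\ (forall x, 0 <= ev f x <= 1) /\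
    (forall x, ev f x <> 0 -> 0 < ev (box h l) x) /\ 0 < ev (box h l') t /\
    forall x, 0 < ev (box h l') x -> 0 < ev (box h l) x /\ ev f x = 0.
Proof.
  intros Ht Hs Hne. set (e := Rabs (ev (h i) s - ev (h i) t) / 2).
  assert (He : 0 < e).
  { assert (0 < Rabs (ev (h i) s - ev (h i) t)) by (apply Rabs_pos_lt; lra).
    unfold e. lra. }
  destruct (tent_base (ev (h i) s) e He) as [j [Hj Hj']].
  destruct (tent_base (ev (h i) t) e He) as [j' [Hk Hk']].
  set (b := box h ((i, j) :: l)).
  assert (Hbs : 0 < ev b s) by (apply box_cons_pos; auto).
  exists (cmin (cconst 1) (cmax (cconst 0) (cscal tX (/ ev b s) b))), ((i, j') :: l).
  assert (Hpos : forall x,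
    ev (cmin (cconst 1) (cmax (cconst 0) (cscal tX (/ ev b s) b))) x <> 0 -> 0 < ev b x).
  { intros x Hx. apply Rnot_le_lt. intros Hle. apply Hx. cbn [proj1_sig cmin cmax cconst cscal].
    assert (0 < / ev b s) by (apply Rinv_0_lt_compat; auto).
    assert (/ ev b s * ev b x <= 0) by nra.
    unfold Rmin, Rmax. repeat destruct Rle_dec; lra. }
  split; [|split; [|split; [|split]]].
  - cbn [proj1_sig cmin cmax cconst cscal]. rewrite Rinv_l by lra.
    unfold Rmin, Rmax. repeat destruct Rle_dec; lra.
  - intros x. cbn [proj1_sig cmin cmax cconst cscal].
    unfold Rmin, Rmax. repeat destruct Rle_dec; lra.
  - intros x Hx. apply Hpos in Hx. apply box_cons_pos in Hx. tauto.
  - apply box_cons_pos; auto.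
  - intros x Hx. apply box_cons_pos in Hx. destruct Hx as [Hx1 Hx2]. split; auto.
    apply NNPP. intros Hn. apply Hpos in Hn. apply box_cons_pos in Hn.
    destruct Hn as [Hn _]. apply Hj' in Hn. apply Hk' in Hx1.
    pose proof (Rabs_triang (ev (h i) s - ev (h i) x) (ev (h i) x - ev (h i) t)) as Hab.
    replace (ev (h i) s - ev (h i) x + (ev (h i) x - ev (h i) t))
      with (ev (h i) s - ev (h i) t) in Hab by ring.
    rewrite (Rabs_minus_sym _ (ev (h i) x)) in Hab. unfold e in *. lra.
Qed.

(* Otherwise there are points [s_k] close to [t], with the same trace up to [k], carrying
   bumps with disjoint supports; these bumps form a null sequence that is never caught. *)
Lemma isolated_in_trace (h : nat -> C) (t : X) :
  exists k l, 0 < ev (box h l) t /\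
    forall s, inherits k t s -> 0 < ev (box h l) s -> forall i, ev (h i) s = ev (h i) t.
Proof.
  apply NNPP. intros Hnot.
  assert (Hs : forall k l, 0 < ev (box h l) t -> exists s i,
    inherits k t s /\ 0 < ev (box h l) s /\ ev (h i) s <> ev (h i) t).
  { intros k l Hl. apply NNPP. intros Hn. apply Hnot. exists k, l. split; auto.
    intros s H1 H2 i. apply NNPP. intros Hne. apply Hn. eauto. }
  (* A state holds the last bump, its point and the current box around [t]; the next bump lives in
     that box and the next box avoids it. *)
  set (St := { p : C * X * list (nat * nat) | 0 < ev (box h (snd p)) t }).
  assert (p0 : St). { exists (czero tX, t, nil). simpl. lra. }
  destruct (dependent_choice (fun k (p q : St) =>
    let l := snd (proj1_sig p) in
    let '(f, s, l') := proj1_sig q in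
    inherits k t s /\ ev f s = 1 /\ (forall x, 0 <= ev f x <= 1) /\
    (forall x, ev f x <> 0 -> 0 < ev (box h l) x) /\
    forall x, 0 < ev (box h l') x -> 0 < ev (box h l) x /\ ev f x = 0) p0) as [st [_ Hst]].
  { intros k [p Hp]. destruct (Hs k (snd p) Hp) as [s [i [H1 [H2 H3]]]].
    destruct (bump_off_point h t s (snd p) i Hp H2 H3) as [f [l' [F1 [F2 [F3 [F4 F5]]]]]].
    exists (exist _ (f, s, l') F4). simpl. auto 10. }
  (* The successor skips the initial state, whose bump and point are dummies. *)
  set (f := fun k => fst (fst (proj1_sig (st (S k))))).
  set (s := fun k => snd (fst (proj1_sig (st (S k))))).
  set (l := fun k => snd (proj1_sig (st k))).
  assert (H : forall k, inherits k t (s k) /\ ev (f k) (s k) = 1 /\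
    (forall x, 0 <= ev (f k) x <= 1) /\
    (forall x, ev (f k) x <> 0 -> 0 < ev (box h (l k)) x) /\
    forall x, 0 < ev (box h (l (S k))) x -> 0 < ev (box h (l k)) x /\ ev (f k) x = 0).
  { intros k. specialize (Hst k). unfold f, s, l.
    destruct (st (S k)) as [[[f' s'] l'] Hp]. exact Hst. }
  assert (Hdec : forall x k j, (k <= j)%nat -> 0 < ev (box h (l j)) x -> 0 < ev (box h (l k)) x).
  { intros x k j Hkj. induction Hkj; auto. intros Hx. apply IHHkj.
    destruct (H m) as [_ [_ [_ [_ H5]]]]. apply H5; auto. }
  assert (Hnull : bounded_null f).
  { split.
    - intros j x. destruct (H j) as [_ [_ [Hb _]]]. specialize (Hb x).
      rewrite Rabs_pos_eq; lra.
    - intros x e He. destruct (classic (exists k, ev (f k) x <> 0)) as [[k Hk]|Hno].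
      (* Later supports lie in a box on which [f k] vanishes, so [x] is in no further support. *)
      + exists (S k). intros j Hj. replace (ev (f j) x) with 0; [rewrite Rabs_R0; auto|].
        symmetry. apply NNPP. intros Hne. apply Hk.
        destruct (H k) as [_ [_ [_ [_ H5]]]]. destruct (H j) as [_ [_ [_ [H4 _]]]].
        apply H5, (Hdec x (S k) j Hj), H4. auto.
      + exists O. intros j _. replace (ev (f j) x) with 0; [rewrite Rabs_R0; auto|].
        symmetry. apply NNPP. intros Hne. apply Hno. eauto. }
  destruct (HA t f Hnull) as [k [n Hkn]].
  destruct (Hkn (Nat.max k n)) as [i [Hi [Ai Hsm]]]; [lia|].
  destruct (H (Nat.max k n)) as [Hin [Hs1 _]].
  assert (Hlt : Rabs (ev (f (Nat.max k n)) (s (Nat.max k n))) < 1).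
  { apply (Hin i); auto. lia. }
  rewrite Hs1, Rabs_R1 in Hlt. lra.
Qed.

(** A point is coded by [k], its trace below [k] and a box from [isolated_in_trace]; of two points
    with one code, each inherits the trace of the other and lies in its box. *)
Lemma countable_joint_image (h : nat -> C) :
  exists g : nat -> option X, forall x, exists n y,
    g n = Some y /\ forall i, ev (h i) x = ev (h i) y.
Proof.
  apply (countable_by_codes (fun c t => let '(k, s, l) := decode_triple c in
    0 < ev (box h (decode_pairs l)) t /\
    (forall i, (i < k)%nat -> (In i (decode_list s) <-> small_at (A i) t)) /\
    forall u, inherits k t u -> 0 < ev (box h (decode_pairs l)) u ->
      forall i, ev (h i) u = ev (h i) t) (fun x y => forall i, ev (h i) x = ev (h i) y)).
  - intros t. destruct (isolated_in_trace h t) as [k [l [H1 H2]]].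
    destruct (finite_trace (fun i => small_at (A i) t) k) as [s Hs].
    destruct (decode_list_surj s) as [s' <-]. destruct (decode_pairs_surj l) as [l' <-].
    destruct (decode_triple_surj k s' l') as [c Hc]. exists c. rewrite Hc. auto.
  - intros c t u. destruct (decode_triple c) as [[k s] l].
    intros [T1 [T2 T3]] [U1 [U2 U3]]. apply U3; auto.
    intros i Hi Hu. apply T2; auto. apply U2; auto.
Qed.

(** The argument behind countable tightness of C_p, with induction on [n] replacing compactness of
    K^n: a finite [L] found for functions small at [x] serves every first point [y] near [x], and
    finitely many such neighbourhoods cover [K]. *)
Lemma finite_tightness (K : X -> Prop) (e : R) (n : nat) : compact tX K -> 0 < e ->
  forall P : C -> Prop,
  (forall F, (forall x, In x F -> K x) -> exists f, P f /\ forall x, In x F -> Rabs (ev f x) < e) ->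
  exists L, (forall f, In f L -> P f) /\
    forall F, (length F <= n)%nat -> (forall x, In x F -> K x) ->
      exists f, In f L /\ forall x, In x F -> Rabs (ev f x) < e.
Proof.
  intros HK He. induction n as [|n IH]; intros P HP;
    destruct (HP nil) as [f0 [Pf0 _]]; try (intros _ []).
  - exists (f0 :: nil). split; [intros f [<-|[]]; auto|].
    intros [|x F] HF _; [|simpl in HF; lia]. exists f0. split; [left; auto|intros _ []].
  - destruct (HK (fun O => exists L, O = (fun y => forall f, In f L -> Rabs (ev f y - 0) < e) /\
      (forall f, In f L -> P f) /\
      forall F, (length F <= n)%nat -> (forall x, In x F -> K x) ->
        exists f, In f L /\ forall x, In x F -> Rabs (ev f x) < e)) as [Os [H1 H2]].
    + intros O [L [-> _]].
      apply open_list_inter with (B := fun f y => Rabs (ev f y - 0) < e).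
      intros f _. apply (proj2_sig f (fun r => Rabs (r - 0) < e)). apply R_open_ball.
    + intros x Kx. destruct (IH (fun f => P f /\ Rabs (ev f x - 0) < e)) as [L [L1 L2]].
      { intros F HF. destruct (HP (x :: F)) as [f [Pf Hf]].
        - intros y [<-|Hy]; auto.
        - exists f. rewrite Rminus_0_r. split; [split; auto|]; intros; apply Hf; simpl; auto. }
      eexists. split; [exists L; split; [reflexivity|split; auto]|].
      * intros f Hf. apply L1; auto.
      * simpl. intros f Hf. apply L1; auto.
    + destruct (list_choice _ Os H1) as [Ls [Ls1 Ls2]].
      exists (f0 :: concat Ls). split.
      * intros f [<-|Hf]; auto. apply in_concat in Hf. destruct Hf as [L [HL Hf]].
        destruct (Ls2 L HL) as [O [_ [_ [HP' _]]]]. auto.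
      * intros [|y F] HF HFK; [exists f0; split; [left; auto|intros _ []]|].
        destruct (H2 y) as [O [HO Oy]]; [apply HFK; left; auto|].
        destruct (Ls1 O HO) as [L [HL [E [_ HL']]]]. subst O.
        destruct (HL' F) as [f [Hf Hf']]; [simpl in HF; lia|intros; apply HFK; right; auto|].
        exists f. split; [right; apply in_concat; eauto|].
        intros x [<-|Hx]; auto. specialize (Oy f Hf). rewrite Rminus_0_r in Oy. auto.
Qed.

Lemma catches_mono t k k' f : (k <= k')%nat -> catches A t k f -> catches A t k' f.
Proof. intros Hk [i [Hi H]]. exists i. split; auto. lia. Qed.

Variable K : nat -> X -> Prop.
Hypothesis K_compact : forall n, compact tX (K n).
Hypothesis K_mono : forall n m x, (n <= m)%nat -> K n x -> K m x.
Hypothesis K_cover : forall x, exists n, K n x.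

(* If every finite [F] and every [k] admitted an uncaught function vanishing on [F],
   tightness would extract countably many of them, and, their joint image being countable,
   a pointwise null sequence that is not caught. *)
Lemma finitely_determined (t : X) : exists k F, forall f : C,
  (forall x, Rabs (ev f x) <= 1) -> (forall x, In x F -> ev f x = 0) -> catches A t k f.
Proof.
  apply NNPP. intros Hnot.
  (* The second index measures at once the compact set, the number of points and the precision. *)
  assert (HL : forall kn : nat * nat, exists L : list C,
    (forall f, In f L -> (forall x, Rabs (ev f x) <= 1) /\ ~ catches A t (fst kn) f) /\
    forall F, (length F <= snd kn)%nat -> (forall x, In x F -> K (snd kn) x) ->
      exists f, In f L /\ forall x, In x F -> Rabs (ev f x) < / (INR (snd kn) + 1)).
  { intros [k n]. apply finite_tightness; [apply K_compact|apply inv_succ_pos|].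
    intros F _. apply NNPP. intros Hn. apply Hnot. exists k, F. intros f Hf1 Hf0.
    apply NNPP. intros Hc. apply Hn. exists f. split; [split; auto|].
    intros x Hx. rewrite Hf0, Rabs_R0 by auto. apply inv_succ_pos. }
  apply choice_fun in HL. destruct HL as [L HL].
  set (h := fun c => nth (snd (Cantor.of_nat c)) (L (Cantor.of_nat (fst (Cantor.of_nat c))))
                       (czero tX)).
  (* Only countably many functions are left, so smallness need only be arranged at the countably
     many representatives [g]. *)
  destruct (countable_joint_image h) as [g Hg].
  assert (Hfin : forall k, exists F, (length F <= k)%nat /\
    forall i y, (i < k)%nat -> g i = Some y -> In y F).
  { induction k as [|k [F [HF1 HF2]]].
    - exists nil. split; auto. intros; lia.
    - destruct (g k) as [y|] eqn:E.
      + exists (y :: F). split; [simpl; lia|]. intros i z Hi Hz.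
        destruct (Nat.eq_dec i k) as [->|]; [left; congruence|right; apply (HF2 i); auto; lia].
      + exists F. split; [lia|]. intros i z Hi Hz.
        destruct (Nat.eq_dec i k) as [->|]; [congruence|apply (HF2 i); auto; lia]. }
  assert (Hf : forall k, exists f : C, (exists c, f = h c) /\
    (forall x, Rabs (ev f x) <= 1) /\ ~ catches A t k f /\
    forall i y, (i < k)%nat -> g i = Some y -> Rabs (ev f y) < / (INR k + 1)).
  { intros k. destruct (Hfin k) as [F [HF1 HF2]].
    destruct (list_bound (fun x n => K n x) F) as [n Hn]; [eauto|auto|].
    (* The maximum meets all demands: [n] places [F] in the compact set, and [k] bounds its length
       and fixes the precision. *)
    destruct (HL (k, Nat.max k n)) as [HL1 HL2]. cbn [fst snd] in HL1, HL2.
    destruct (HL2 F) as [f [Hf Hf']].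
    - lia.
    - intros x Hx. apply (K_mono n); auto. lia.
    - exists f. destruct (HL1 f Hf) as [Hb Hc]. split; [|split; [|split]]; auto.
      + destruct (In_nth _ _ (czero tX) Hf) as [q [_ Hq]].
        exists (Cantor.to_nat (Cantor.to_nat (k, Nat.max k n), q)).
        unfold h. rewrite !Cantor.cancel_of_to. cbn [fst snd].
        rewrite !Cantor.cancel_of_to. auto.
      + intros i y Hi Hy. eapply Rlt_le_trans; [apply Hf'; eauto|].
        apply inv_succ_le. lia. }
  apply choice_fun in Hf. destruct Hf as [f Hf].
  assert (Hnull : bounded_null f).
  { split; [intros; apply Hf|]. intros x e He.
    destruct (Hg x) as [i [y [Hi Hxy]]].
    destruct (exists_inv_succ_lt e He) as [n Hn].
    exists (Nat.max (S i) n). intros j Hj. destruct (Hf j) as [[c Hc] [_ [_ Hsm]]].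
    rewrite Hc, Hxy, <- Hc.
    eapply Rlt_trans; [apply (Hsm i); auto; lia|].
    eapply Rle_lt_trans; [|apply Hn]. apply inv_succ_le. lia. }
  destruct (HA t f Hnull) as [k [n Hkn]].
  destruct (Hf (Nat.max k n)) as [_ [_ [Hc _]]]. apply Hc.
  apply catches_mono with k; [lia|]. apply Hkn. lia.
Qed.

Lemma null_network_countable : tychonoff tX -> countable_type X.
Proof.
  intros HX.
  (* [good] mentions indices but not [t], so [F] can be chosen once for each pair of [k] and a coded
     trace. *)
  set (good := fun (k : nat) (s : list nat) (F : list X) => forall f : C,
    (forall x, Rabs (ev f x) <= 1) -> (forall x, In x F -> ev f x = 0) ->
    exists i, (i < k)%nat /\ In i s /\ A i f).
  assert (HF : forall c : nat * nat, exists F, forall F',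
    good (fst c) (decode_list (snd c)) F' -> good (fst c) (decode_list (snd c)) F).
  { intros c. destruct (classic (exists F, good (fst c) (decode_list (snd c)) F))
      as [[F HF]|Hno].
    - exists F. auto.
    - exists nil. intros F' HF'. exfalso; eauto. }
  apply choice_fun in HF. destruct HF as [F HF].
  exists (fun n => nth_error (F (Cantor.of_nat (fst (Cantor.of_nat n)))) (snd (Cantor.of_nat n))).
  intros t. destruct (finitely_determined t) as [k [F' HF']].
  destruct (finite_trace (fun i => small_at (A i) t) k) as [s Hs].
  destruct (decode_list_surj s) as [s' <-].
  assert (Hgood : good k (decode_list s') (F (k, s'))).
  { apply (HF (k, s') F'). cbn [fst snd]. intros f Hf1 Hf2.
    destruct (HF' f Hf1 Hf2) as [i [Hi [Ai Hsm]]]. exists i. split; auto. split; auto.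
    apply Hs; auto. }
  assert (Ht : In t (F (k, s'))).
  { apply NNPP. intros Hn.
    destruct (tychonoff_separates_compact tX _ t HX (compact_list tX (F (k, s'))) Hn)
      as [f [Hft [Hf0 Hf1]]].
    destruct (Hgood f Hf1 Hf0) as [i [Hi [Hin Ai]]].
    apply Hs in Hin; auto. specialize (Hin f Ai). rewrite Hft, Rabs_R1 in Hin. lra. }
  apply In_nth_error in Ht. destruct Ht as [q Hq].
  exists (Cantor.to_nat (Cantor.to_nat (k, s'), q)).
  rewrite !Cantor.cancel_of_to. cbn [fst snd]. rewrite !Cantor.cancel_of_to. auto.
Qed.

End NullNetwork.

Lemma weakly_aleph_countable :
  tychonoff tX -> metrizable_Cc tX -> weakly_aleph tX -> countable_type X.
Proof.
  intros HX Hmet Hal. destruct (weakly_aleph_null_network Hal) as [A HA].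
  destruct (metrizable_hemicompact tX HX Hmet) as [K [HK [Hmono Hhem]]].
  apply (null_network_countable A HA K HK Hmono); auto.
  intros x. destruct (Hhem _ (compact_list tX (x :: nil))) as [n Hn].
  exists n. apply Hn. left; auto.
Qed.

End Countability.

(** * Countable implies weakly aleph-zero *)

Lemma Un_cv_dist_le (u : nat -> R) (l a b : R) (N : nat) :
  Un_cv u l -> (forall n, (N <= n)%nat -> Rabs (u n - a) <= b) -> Rabs (l - a) <= b.
Proof.
  intros Hu H. apply Rnot_lt_le. intros Hlt.
  destruct (Hu (Rabs (l - a) - b)) as [n Hn]; [lra|].
  specialize (Hn (Nat.max n N)). specialize (H (Nat.max n N)).
  unfold Rdist in Hn.
  assert (H1 : Rabs (u (Nat.max n N) - l) < Rabs (l - a) - b) by (apply Hn; lia).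
  assert (H2 : Rabs (u (Nat.max n N) - a) <= b) by (apply H; lia).
  pose proof (Rabs_triang (l - u (Nat.max n N)) (u (Nat.max n N) - a)) as Ht.
  replace (l - u (Nat.max n N) + (u (Nat.max n N) - a)) with (l - a) in Ht by ring.
  rewrite (Rabs_minus_sym l (u _)) in Ht. lra.
Qed.

(** * Weakly compact sets are bounded on compact sets *)

Section WeaklyCompact.
Context {X : Type} (tX : topology X).
Local Notation C := (CX tX).

Lemma dominated_add_eval (K : X -> Prop) (c a : R) (phi : C -> R) (x : X) :
  K x -> 0 <= a -> dominated tX K c phi ->
  dominated tX K (c + a) (fun g => phi g + a * ev g x).
Proof.
  intros Kx Ha [[H1 H2] [Hc H]]. split; [split|split].
  - intros f g. rewrite H1. simpl. ring.
  - intros r f. rewrite H2. simpl. ring.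
  - lra.
  - intros g s Hs Hg. pose proof (Rabs_triang (phi g) (a * ev g x)) as Ht.
    rewrite Rabs_mult, (Rabs_pos_eq a) in Ht by auto.
    specialize (H g s Hs Hg). specialize (Hg x Kx).
    assert (a * Rabs (ev g x) <= a * s) by (apply Rmult_le_compat_l; auto). lra.
Qed.

Lemma dominated_weakly_compact_bounded (Q : C -> Prop) K c phi :
  compact (Cc_weak tX) Q -> compact tX K -> dominated tX K c phi ->
  exists m, 0 <= m /\ forall f, Q f -> Rabs (phi f) <= m.
Proof.
  intros HS HK Hphi. apply continuous_compact_bounded with (1 := HS).
  intros U HU. apply weak_preimage_open with (1 := HK) (2 := Hphi). auto.
Qed.

(* [phi_n], a constant dominating it, and the weight of the next point mass *)
Definition hump_state : Type := (C -> R) * R * R.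

(** The last inequality makes the new functional at least [n + 2] in absolute value at [f]; the
    relation of [e'] to [e] keeps later point masses, of total weight at most [2 * e'], from
    changing this by more than 1. *)
Definition hump_step (Q : C -> Prop) (K : X -> Prop) (n : nat) (p q : hump_state) : Prop :=
  let '(phi, c, e) := p in
  let '(phi', c', e') := q in
  exists f x m, Q f /\ K x /\ 0 <= m /\ (forall y, K y -> Rabs (ev f y) <= m) /\
    phi' = (fun g => phi g + e * ev g x) /\ c' = c + e /\ 0 < e' /\
    e' * (2 * (1 + m)) = e /\ INR n + 2 + Rabs (phi f) <= e * Rabs (ev f x).

(* Gliding hump: if [Q] were unbounded on [K], a suitable series of point masses at points
   of [K] would define a continuous functional that is unbounded on [Q]. *)
Lemma weakly_compact_bounded (Q : C -> Prop) (K : X -> Prop) :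
  compact (Cc_weak tX) Q -> compact tX K ->
  exists m, forall f x, Q f -> K x -> Rabs (ev f x) <= m.
Proof.
  intros HS HK. apply NNPP. intros Hnot.
  assert (Hbig : forall m, exists f x, Q f /\ K x /\ m < Rabs (ev f x)).
  { intros m. apply NNPP. intros Hn. apply Hnot. exists m. intros f x Sf Kx.
    apply Rnot_lt_le. intros Hlt. apply Hn. eauto. }
  set (ok := fun p : hump_state => let '(phi, c, e) := p in dominated tX K c phi /\ 0 < e).
  assert (Hstart : ok (fun _ => 0, 0, 1)).
  { split; [|lra]. split; [split; intros; ring|]. split; [lra|]. intros.
    rewrite Rabs_R0. lra. }
  destruct (dependent_choice (fun n (p q : {p | ok p}) =>
      hump_step Q K n (proj1_sig p) (proj1_sig q)) (exist _ _ Hstart)) as [st [Hst0 Hst]].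
  { intros n [[[phi c] e] [Hphi He]].
    destruct (dominated_weakly_compact_bounded Q K c phi HS HK Hphi) as [M [HM0 HM]].
    (* [M] bounds the functional built so far on [Q], so a value of this size outweighs it. *)
    destruct (Hbig ((INR n + 2 + M) / e)) as [f [x [Sf [Kx Hfx]]]].
    destruct (continuous_compact_bounded tX K (ev f) HK (proj2_sig f)) as [m [Hm0 Hm]].
    assert (He' : 0 < e / (2 * (1 + m))) by (apply Rdiv_lt_0_compat; lra).
    assert (Hok : ok ((fun g => phi g + e * ev g x), c + e, e / (2 * (1 + m)))).
    { split; auto. apply dominated_add_eval; auto. lra. }
    exists (exist _ _ Hok). simpl. exists f, x, m. repeat (split; auto).
    - field. lra.
    - specialize (HM f Sf).
      apply Rmult_lt_compat_l with (r := e) in Hfx; auto.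
      replace (e * ((INR n + 2 + M) / e)) with (INR n + 2 + M) in Hfx by (field; lra). lra. }
  set (phi := fun n => fst (fst (proj1_sig (st n)))).
  set (c := fun n => snd (fst (proj1_sig (st n)))).
  set (e := fun n => snd (proj1_sig (st n))).
  assert (Hdom : forall n, dominated tX K (c n) (phi n) /\ 0 < e n).
  { intros n. unfold phi, c, e. destruct (st n) as [[[a b] d] Hp]. exact Hp. }
  assert (Hstep : forall n, hump_step Q K n (phi n, c n, e n) (phi (S n), c (S n), e (S n))).
  { intros n. specialize (Hst n). unfold phi, c, e.
    destruct (proj1_sig (st n)) as [[a b] d].
    destruct (proj1_sig (st (S n))) as [[a' b'] d']. exact Hst. }
  assert (H0 : c O = 0 /\ e O = 1) by (unfold c, e; rewrite Hst0; auto).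
  assert (Hhalf : forall n, 2 * e (S n) <= e n).
  { intros n. destruct (Hstep n) as [f [x [m [_ [_ [Hm [_ [_ [_ [He [Ee _]]]]]]]]]]].
    rewrite <- Ee. nra. }
  (* As the weights at least halve, the spent weight plus twice the next one never grows; the limit
     thus gets the constant 2. *)
  assert (Hc : forall n, c n + 2 * e n <= 2).
  { induction n as [|n IH]; [destruct H0; lra|].
    destruct (Hstep n) as [f [x [m [_ [_ [Hm [_ [_ [Ec _]]]]]]]]].
    rewrite Ec. specialize (Hhalf n). lra. }
  assert (He_pow : forall n, e n <= (1 / 2) ^ n).
  { induction n as [|n IH]; [destruct H0; simpl; lra|].
    specialize (Hhalf n). simpl. lra. }
  (* Telescoping form of the tail estimate, with which the induction on [k] closes. *)
  assert (Hdiff : forall g s, 0 <= s -> (forall y, K y -> Rabs (ev g y) <= s) ->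
    forall n k, Rabs (phi (n + k)%nat g - phi n g) <= (2 * e n - 2 * e (n + k)%nat) * s).
  { intros g s Hs Hg n. induction k as [|k IH].
    - rewrite Nat.add_0_r, !Rminus_diag, Rabs_R0. lra.
    - rewrite Nat.add_succ_r.
      destruct (Hstep (n + k)%nat) as [f [x [m [_ [Kx [Hm [_ [Ephi _]]]]]]]].
      destruct (Hdom (n + k)%nat) as [_ Hpos]. specialize (Hhalf (n + k)%nat).
      rewrite Ephi.
      replace (phi (n + k)%nat g + e (n + k)%nat * ev g x - phi n g)
        with ((phi (n + k)%nat g - phi n g) + e (n + k)%nat * ev g x) by ring.
      eapply Rle_trans; [apply Rabs_triang|].
      rewrite Rabs_mult, (Rabs_pos_eq (e (n + k)%nat)) by lra.
      specialize (Hg x Kx).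
      assert (e (n + k)%nat * Rabs (ev g x) <= e (n + k)%nat * s)
        by (apply Rmult_le_compat_l; lra).
      nra. }
  assert (Hdiff' : forall g s, 0 <= s -> (forall y, K y -> Rabs (ev g y) <= s) ->
    forall n k, (n <= k)%nat -> Rabs (phi k g - phi n g) <= 2 * e n * s).
  { intros g s Hs Hg n k Hnk. specialize (Hdiff g s Hs Hg n (k - n)%nat).
    replace (n + (k - n))%nat with k in Hdiff by lia.
    destruct (Hdom k) as [_ Hk]. nra. }
  assert (Hlim : forall g, exists l, Un_cv (fun n => phi n g) l).
  { intros g.
    destruct (continuous_compact_bounded tX K (ev g) HK (proj2_sig g)) as [s [Hs Hg]].
    destruct (R_complete (fun n => phi n g)) as [l Hl]; [|exists l; auto].
    intros eps Heps.
    destruct (pow_lt_1_zero (1 / 2)) with (y := eps / (4 * (s + 1))) as [N HN].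
    { rewrite Rabs_pos_eq; lra. }
    { apply Rdiv_lt_0_compat; lra. }
    assert (HeN : 4 * e N * s < eps).
    { specialize (HN N (le_n _)). rewrite Rabs_pos_eq in HN by (apply pow_le; lra).
      specialize (He_pow N). destruct (Hdom N) as [_ HeN].
      assert (e N * (4 * (s + 1)) < eps).
      { apply Rlt_le_trans with (eps / (4 * (s + 1)) * (4 * (s + 1))).
        - apply Rmult_lt_compat_r; lra.
        - right. field. lra. }
      nra. }
    exists N. intros n m Hn Hm. unfold Rdist.
    pose proof (Hdiff' g s Hs Hg N n Hn) as D1. pose proof (Hdiff' g s Hs Hg N m Hm) as D2.
    pose proof (Rabs_triang (phi n g - phi N g) (phi N g - phi m g)) as Ht.
    rewrite (Rabs_minus_sym (phi N g) (phi m g)) in Ht.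
    replace (phi n g - phi N g + (phi N g - phi m g)) with (phi n g - phi m g) in Ht by ring.
    lra. }
  apply choice_fun in Hlim. destruct Hlim as [psi Hpsi].
  assert (Hpsi_dom : dominated tX K 2 psi).
  { split; [split|split].
    - intros f g. apply UL_sequence with (1 := Hpsi _).
      assert (E : (fun n => phi n (cadd tX f g)) = (fun n => phi n f + phi n g)).
      { apply functional_extensionality. intros n. apply Hdom. }
      rewrite E. apply CV_plus; auto.
    - intros r f. apply UL_sequence with (1 := Hpsi _).
      assert (E : (fun n => phi n (cscal tX r f)) = (fun n => r * phi n f)).
      { apply functional_extensionality. intros n. apply Hdom. }
      rewrite E. apply CV_mult with (An := fun _ => r); auto.
      intros eps Heps. exists O. intros n _. unfold Rdist. rewrite Rminus_diag, Rabs_R0. auto.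
    - lra.
    - intros g s Hs Hg. rewrite <- (Rminus_0_r (psi g)).
      apply Un_cv_dist_le with (1 := Hpsi g) (N := O). intros n _. rewrite Rminus_0_r.
      destruct (Hdom n) as [[_ [_ Hn]] Hen]. specialize (Hn g s Hs Hg).
      specialize (Hc n). nra. }
  (* [psi] is bounded by [M] on [Q], while a stage [n] with [M <= INR n] forces |psi f| >= n + 1. *)
  destruct (dominated_weakly_compact_bounded Q K 2 psi HS HK Hpsi_dom) as [M [_ HM]].
  destruct (exists_INR_ge M) as [n Hn].
  destruct (Hstep n) as [f [x [m [Sf [Kx [Hm [Hfm [Ephi [_ [He [Ee Hbg]]]]]]]]]]].
  specialize (HM f Sf).
  assert (D : Rabs (psi f - phi (S n) f) <= 2 * e (S n) * m).
  { apply Un_cv_dist_le with (1 := Hpsi f) (N := S n). intros k Hk. apply Hdiff'; auto. }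
  assert (2 * e (S n) * m <= 1).
  { assert (e n <= 1).
    { eapply Rle_trans; [apply He_pow|].
      rewrite <- (pow1 n) at 2. apply pow_incr. lra. }
    nra. }
  rewrite Ephi in D.
  destruct (Hdom n) as [_ Hen].
  assert (e n * Rabs (ev f x) = Rabs (e n * ev f x)).
  { rewrite Rabs_mult, (Rabs_pos_eq (e n)); lra. }
  pose proof (Rabs_triang (psi f) (- (psi f - (phi n f + e n * ev f x)) - phi n f)) as T1.
  pose proof (Rabs_triang (- (psi f - (phi n f + e n * ev f x))) (- phi n f)) as T2.
  replace (psi f + (- (psi f - (phi n f + e n * ev f x)) - phi n f)) with (e n * ev f x)
    in T1 by ring.
  rewrite !Rabs_Ropp in T2. unfold Rminus at 1 in T1. lra.
Qed.

(** * The countable k-network over a countable space *)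

Section CountableSpace.
Variable points : nat -> option X.
Hypothesis points_surj : forall x, exists n, points n = Some x.

(** A rational box of the topology of pointwise convergence; an index with no point imposes
    nothing. *)
Definition cell (l : list (nat * nat)) (g : C) : Prop :=
  forall ij, In ij l -> forall x, points (fst ij) = Some x -> 0 < tent (snd ij) (ev g x).

Lemma cell_weak_open l : open (Cc_weak tX) (cell l).
Proof.
  apply open_list_inter with
    (B := fun ij (g : C) => forall x, points (fst ij) = Some x -> 0 < tent (snd ij) (ev g x)).
  intros [i j] _. cbn [fst snd]. destruct (points i) as [x|].
  - apply open_ext with (A := fun g : C => 0 < tent j (ev g x)).
    + intros g. split; [intros H y E; injection E as <-; auto|auto].
    + apply weak_eval_open with (U := fun y => 0 < tent j y). intros y Hy.
      exists (tent j y). split; auto. intros z Hz.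
      pose proof (tent_lipschitz j y z). pose proof (Rle_abs (tent j y - tent j z)).
      rewrite Rabs_minus_sym in Hz. lra.
  - apply open_ext with (2 := open_full _ _). intros g. split; auto. intros; discriminate.
Qed.

Lemma cell_app l l' g : cell (l ++ l') g <-> cell l g /\ cell l' g.
Proof.
  unfold cell. split.
  - intros H. split; intros ij Hij; apply H; apply in_or_app; auto.
  - intros [H1 H2] ij Hij. apply in_app_or in Hij. destruct Hij; auto.
Qed.

Lemma cell_approx (f : C) (n : nat) : exists l, cell l f /\
  forall g, cell l g -> forall i x, (i < n)%nat -> points i = Some x ->
    Rabs (ev g x - ev f x) < / (INR n + 1).
Proof.
  assert (H : forall d k, 0 < d -> exists l, cell l f /\
    forall g, cell l g -> forall i x, (i < k)%nat -> points i = Some x ->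
      Rabs (ev g x - ev f x) < d).
  { intros d k Hd. induction k as [|k [l [H1 H2]]].
    - exists nil. split; [intros ij []|]. intros; lia.
    - destruct (points k) as [y|] eqn:E.
      + destruct (tent_base (ev f y) d Hd) as [j [Hj Hj']].
        exists ((k, j) :: l). split.
        * intros ij [<-|Hij]; [|apply H1; auto]. simpl. intros x Ex.
          rewrite E in Ex. injection Ex as <-. auto.
        * intros g Hg i x Hi Ex. destruct (Nat.eq_dec i k) as [->|Hne].
          -- rewrite E in Ex. injection Ex as <-. apply Hj'.
             apply (Hg (k, j)); [left; auto|auto].
          -- apply (H2 g) with i; auto; [|lia]. intros ij Hij. apply Hg. right; auto.
      + exists l. split; auto. intros g Hg i x Hi Ex.
        destruct (Nat.eq_dec i k) as [->|Hne]; [congruence|]. apply (H2 g) with i; auto. lia. }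
  apply H. apply inv_succ_pos.
Qed.

(** Otherwise ever finer cells yield functions bounded by [m] on [K] that converge to [f] pointwise
    but keep [phi] at distance [d], against dominated convergence. *)
Lemma functional_cell_continuous K c phi (m : R) (f : C) (d : R) :
  compact tX K -> dominated tX K c phi -> (forall x, K x -> Rabs (ev f x) <= m) -> 0 < d ->
  exists l, cell l f /\ forall g, cell l g -> (forall x, K x -> Rabs (ev g x) <= m) ->
    Rabs (phi g - phi f) < d.
Proof.
  intros HK Hphi Hf Hd. apply NNPP. intros Hnot.
  assert (Hg : forall n, exists g : C, (forall x, K x -> Rabs (ev g x) <= m) /\
    d <= Rabs (phi g - phi f) /\
    forall i x, (i < n)%nat -> points i = Some x -> Rabs (ev g x - ev f x) < / (INR n + 1)).
  { intros n. destruct (cell_approx f n) as [l [H1 H2]]. apply NNPP. intros Hn. apply Hnot.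
    exists l. split; auto. intros g Hlg Hgm. apply Rnot_le_lt. intros Hle. apply Hn.
    exists g. split; [auto|split; [auto|exact (H2 g Hlg)]]. }
  apply choice_fun in Hg. destruct Hg as [g Hg].
  (* Clamping at this height bounds the differences on all of X without changing them on [K]. *)
  set (b := cconst (tX := tX) (2 * Rabs m)).
  set (h := fun n => cclamp b (csub tX (g n) f)).
  pose proof (Rabs_pos m) as Hm0.
  destruct (dominated_convergence tX K c phi HK Hphi h (2 * Rabs m)) with (e := d) as [n Hn].
  - intros j x. apply (cclamp_bound tX b). simpl. lra.
  - intros x e He. destruct (points_surj x) as [i Hi].
    destruct (exists_inv_succ_lt e He) as [n Hn].
    exists (Nat.max (S i) n). intros j Hj.
    apply Rle_lt_trans with (Rabs (ev (csub tX (g j) f) x)).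
    + apply (cclamp_abs_le tX b). simpl. lra.
    + simpl. replace (ev (g j) x + -1 * ev f x) with (ev (g j) x - ev f x) by ring.
      destruct (Hg j) as [_ [_ Hgj]].
      eapply Rlt_trans; [apply (Hgj i); auto; lia|].
      eapply Rle_lt_trans; [|apply Hn]. apply inv_succ_le. lia.
  - auto.
  - specialize (Hn n (le_n _)). destruct (Hg n) as [Hgm [Hgd _]].
    assert (E : phi (h n) = phi (g n) - phi f).
    { rewrite <- (linear_sub tX phi) by apply Hphi.
      apply (dominated_agree tX K c phi); auto. intros x Kx. apply cclamp_id.
      simpl. specialize (Hgm x Kx). specialize (Hf x Kx).
      eapply Rle_trans; [apply Rabs_triang|].
      replace (-1 * ev f x) with (- ev f x) by ring. rewrite Rabs_Ropp.
      pose proof (Rle_abs m). lra. }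
    rewrite E in Hn. lra.
Qed.

Variable K : nat -> X -> Prop.
Hypothesis K_compact : forall n, compact tX (K n).
Hypothesis K_mono : forall n m x, (n <= m)%nat -> K n x -> K m x.
Hypothesis K_hemi : forall L, compact tX L -> exists n, forall x, L x -> K n x.

Definition network_member (n m : nat) (l : list (nat * nat)) (g : C) : Prop :=
  (forall x, K n x -> Rabs (ev g x) <= INR m) /\ cell l g.

(** [K n] carries all functionals of a basic neighbourhood of [f], and [m] bounds [Q] on [K n];
    under that bound a cell controls each functional. *)
Lemma network_refines (Q U : C -> Prop) (f : C) :
  compact (Cc_weak tX) Q -> open (Cc_weak tX) U -> Q f -> U f ->
  exists n m l, cell l f /\ (forall g x, Q g -> K n x -> Rabs (ev g x) <= INR m) /\
    forall g, network_member n m l g -> U g.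
Proof.
  intros HS HU Sf Uf. destruct (HU f Uf) as [bs [H1 H2]].
  destruct (list_bound (fun (B : C -> Prop) n => exists phi c V, dominated tX (K n) c phi /\
      R_open V /\ B = (fun g => V (phi g))) bs) as [n Hn].
  { intros B n n' [phi [c [V [Hphi HV]]]] Hnn. exists phi, c, V. split; auto.
    apply dominated_subset with (2 := Hphi). intros x. apply K_mono; auto. }
  { intros B HB. destruct (H1 B HB) as [[phi [V [Hl [Hc [HV E]]]]] _].
    destruct (continuous_functional_dominated tX phi Hl Hc) as [L [c [HL Hphi]]].
    destruct (K_hemi L HL) as [n Hn]. exists n, phi, c, V. split; auto.
    apply dominated_subset with (2 := Hphi). auto. }
  destruct (weakly_compact_bounded Q (K n) HS (K_compact n)) as [M HM].
  destruct (exists_INR_ge M) as [m Hm].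
  assert (Hb : forall g x, Q g -> K n x -> Rabs (ev g x) <= INR m).
  { intros g x Sg Kx. specialize (HM g x Sg Kx). lra. }
  assert (Hl : exists l, cell l f /\ forall g, network_member n m l g ->
    forall B, In B bs -> B g).
  { clear H2. induction bs as [|B bs IH].
    - exists nil. split; [intros ij []|]. intros g _ B [].
    - destruct IH as [l [L1 L2]]; [intros; apply H1; right; auto|intros; apply Hn; right; auto|].
      destruct (Hn B) as [phi [c [V [Hphi [HV E]]]]]; [left; auto|].
      destruct (H1 B) as [_ Bf]; [left; auto|]. subst B.
      destruct (HV _ Bf) as [d [Hd HdV]].
      destruct (functional_cell_continuous (K n) c phi (INR m) f d (K_compact n) Hphi)
        as [l' [L1' L2']]; auto.
      exists (l' ++ l). split; [apply cell_app; auto|].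
      intros g [Gm Gc] B HB. apply cell_app in Gc. destruct Gc as [Gc1 Gc2].
      destruct HB as [<-|HB].
      + apply HdV. apply L2'; auto.
      + apply L2; auto. split; auto. }
  destruct Hl as [l [L1 L2]]. exists n, m, l. split; [|split]; auto.
  intros g Hg. apply H2, L2, Hg.
Qed.

Lemma countable_weakly_aleph0 : weakly_aleph0 tX.
Proof.
  split; [apply weak_regular|].
  set (mem := fun c => let '(n, m, l) := decode_triple c in network_member n m (decode_pairs l)).
  exists (fun N => exists c, Some (mem c) = Some N). split.
  2:{ exists (fun c => Some (mem c)). tauto. }
  intros Q U HS HU HSU.
  (* The cover consists of cells, which are weakly open; as [Q] obeys the bounds, its part in a cell
     lies in the corresponding network member. *)
  destruct (HS (fun O => exists c n m l, decode_triple c = (n, m, l) /\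
    O = cell (decode_pairs l) /\ (forall g x, Q g -> K n x -> Rabs (ev g x) <= INR m) /\
    forall g, mem c g -> U g)) as [Os [H1 H2]].
  - intros O [c [n [m [l [_ [-> _]]]]]]. apply cell_weak_open.
  - intros f Sf. destruct (network_refines Q U f HS HU Sf (HSU f Sf)) as [n [m [l [L1 [L2 L3]]]]].
    destruct (decode_pairs_surj l) as [l' <-].
    destruct (decode_triple_surj n m l') as [c Hc].
    exists (cell (decode_pairs l')). split; auto. exists c, n, m, l'.
    unfold mem. rewrite Hc. auto.
  - destruct (list_choice (fun O N => exists c, Some (mem c) = Some N /\
      (forall g, Q g -> O g -> N g) /\ forall g, N g -> U g) Os) as [Ns [N1 N2]].
    + intros O HO. destruct (H1 O HO) as [c [n [m [l [Hc [-> [Hb Hsub]]]]]]].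
      exists (mem c), c. split; auto. split; auto. intros g Sg Og.
      unfold mem. rewrite Hc. split; auto.
    + exists Ns. split; [|split].
      * intros N HN. destruct (N2 N HN) as [O [_ [c [E _]]]]. eauto.
      * intros f Sf. destruct (H2 f Sf) as [O [HO Of]].
        destruct (N1 O HO) as [N [HN [c [_ [HN' _]]]]]. exists N. auto.
      * intros N HN. destruct (N2 N HN) as [O [_ [c [_ [_ HNU]]]]]. auto.
Qed.

End CountableSpace.
End WeaklyCompact.

(** Each layer holds at most one member, so the whole space serves as neighbourhood. *)
Lemma aleph0_aleph {T : Type} (t : topology T) : aleph0_space t -> aleph_space t.
Proof.
  intros [Hreg [N [HN [g Hg]]]]. split; auto. exists N. split; auto.
  exists (fun n A => g n = Some A). split; auto.
  intros n x. exists (fun _ => True). split; [apply open_full|]. split; auto.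
  destruct (g n) as [A|].
  - exists (A :: nil). intros B E _. injection E as <-. left; auto.
  - exists nil. intros B E. discriminate.
Qed.

Theorem theorem1p1 (X : Type) (tX : topology X)
  (HX : tychonoff tX) (HF : frechet_Cc tX) :
  (weakly_aleph tX <-> weakly_aleph0 tX) /\
  (weakly_aleph0 tX <-> countable_type X).
Proof.
  destruct HF as [_ [Hmet _]].
  pose proof (weakly_aleph_countable tX HX Hmet) as Hac.
  assert (Hcb : countable_type X -> weakly_aleph0 tX).
  { intros [points Hpoints].
    destruct (metrizable_hemicompact tX HX Hmet) as [K [HK [Hmono Hhem]]].
    apply (countable_weakly_aleph0 tX points Hpoints K); auto. }
  pose proof (aleph0_aleph (Cc_weak tX)) as Hba.
  unfold weakly_aleph, weakly_aleph0 in *. tauto.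
Qed.
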